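(* Let $T\in B(\mathcal{H})$ be an operator of class $C_0$ such that $$\operatorname{Ext}^1_{A(\mathbb{D})}(T,T)=0.$$ Then the spectrum of $T$ lies on the unit circle.
   Context: $\mathbb{D}$ is the open unit disc in $\mathbb{C}$ and $A(\mathbb{D})$ is the disc algebra (functions holomorphic on $\mathbb{D}$ and continuous on $\overline{\mathbb{D}}$). A bounded linear operator $T$ on a Hilbert space $\mathcal{H}$ is polynomially bounded if there is a constant $C>0$ with $\|p(T)\|\le C\sup_{|z|<1}|p(z)|$ for every polynomial $p$; in that case $(\mathcal{H},T)$ (or simply $T$) is called a Hilbert module (over $A(\mathbb{D})$, via $f\cdot h=f(T)h$). For Hilbert modules $(\mathcal{H}_1,T_1)$ and $(\mathcal{H}_2,T_2)$, the extension group $\operatorname{Ext}^1_{A(\mathbb{D})}(T_2,T_1)$ is identified with the quotient $\mathcal{A}/\mathcal{J}$, where $\mathcal{A}$ is the space of bounded operators $X:\mathcal{H}_2\to\mathcal{H}_1$ for which $\begin{pmatrix}T_1&X\\0&T_2\end{pmatrix}$ on $\mathcal{H}_1\oplus\mathcal{H}_2$ is polynomially bounded, and $\mathcal{J}$ is the space of operators of the form $T_1L-LT_2$ with $L:\mathcal{H}_2\to\mathcal{H}_1$ bounded. $H^\infty$ is the algebra of bounded holomorphic functions on $\mathbb{D}$. A completely non-unitary contraction $T\in B(\mathcal{H})$ is of class $C_0$ if its Sz.-Nagy--Foias functional calculus $u\mapsto u(T)$, $u\in H^\infty$, has non-trivial kernel, i.e. there is a non-zero $u\in H^\infty$ with $u(T)=0$.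 (Contractions are polynomially bounded by von Neumann's inequality.) *)

(* Defs.v *)
From Stdlib Require Import Reals.
From Coquelicot Require Import Coquelicot.

Open Scope R_scope.

(* A complex Hilbert space: a complete normed C-module whose norm comes from an
   inner product, linear in the first argument. *)
Record HilbertSpace := {
  hilbert_carrier :> CompleteNormedModule C_AbsRing;
  inner : hilbert_carrier -> hilbert_carrier -> C;
  inner_plus_l : forall x y z : hilbert_carrier,
    inner (plus x y) z = Cplus (inner x z) (inner y z);
  inner_scal_l : forall (c : C) (x y : hilbert_carrier),
    inner (scal c x) y = Cmult c (inner x y);
  inner_conj : forall x y : hilbert_carrier, inner y x = Cconj (inner x y);
  inner_norm : forall x : hilbert_carrier, inner x x = RtoC (norm x ^ 2)
}.

Arguments inner {h} _ _.

(* Coquelicot's [is_linear] includes boundedness, so [is_linear T] says that T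
   is a bounded linear operator. *)

(* The polynomial p = a_0 + a_1 z + ... + a_n z^n at a number and at an
   operator. *)
Definition poly_eval (a : nat -> C) (n : nat) (z : C) : C :=
  sum_n (fun k => Cmult (a k) (Cpow z k)) n.

Definition poly_apply {V : NormedModule C_AbsRing}
    (a : nat -> C) (n : nat) (T : V -> V) (h : V) : V :=
  sum_n (fun k => scal (a k) (Nat.iter k T h)) n.

(* [s] is the supremum of |p| over the open unit disc. *)
Definition polynomially_bounded {V : NormedModule C_AbsRing} (T : V -> V) : Prop :=
  exists K : R, 0 < K /\
    forall (a : nat -> C) (n : nat) (s : R),
      is_lub (fun x => exists z : C, Cmod z < 1 /\ x = Cmod (poly_eval a n z)) s ->
      forall h : V, norm (poly_apply a n T h) <= K * s * norm h.

(* The operator matrix [T1 X; 0 T2]; the norm of the product of two normed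
   modules is sqrt (|h1|^2 + |h2|^2), that of the orthogonal direct sum. *)
Definition upper_triangular {H1 H2 : HilbertSpace}
    (T1 : H1 -> H1) (X : H2 -> H1) (T2 : H2 -> H2) (h : H1 * H2) : H1 * H2 :=
  (plus (T1 (fst h)) (X (snd h)), T2 (snd h)).

(* The space A of the presentation Ext^1(T2, T1) = A / J. *)
Definition ext_cocycle {H1 H2 : HilbertSpace}
    (T2 : H2 -> H2) (T1 : H1 -> H1) (X : H2 -> H1) : Prop :=
  is_linear X /\
  polynomially_bounded (V := prod_NormedModule C_AbsRing H1 H2)
    (upper_triangular T1 X T2).

(* The space J. *)
Definition ext_coboundary {H1 H2 : HilbertSpace}
    (T2 : H2 -> H2) (T1 : H1 -> H1) (X : H2 -> H1) : Prop :=
  exists L : H2 -> H1, is_linear L /\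
    forall h : H2, X h = minus (T1 (L h)) (L (T2 h)).

(* Equality of the classes of X and Y in A / J. *)
Definition ext_equiv {H1 H2 : HilbertSpace}
    (T2 : H2 -> H2) (T1 : H1 -> H1) (X Y : H2 -> H1) : Prop :=
  ext_coboundary T2 T1 (fun h => minus (X h) (Y h)).

Definition Ext1_eq_0 {H1 H2 : HilbertSpace}
    (T2 : H2 -> H2) (T1 : H1 -> H1) : Prop :=
  forall X : H2 -> H1, ext_cocycle T2 T1 X ->
    ext_equiv T2 T1 X (fun _ => zero).

Definition contraction {H : HilbertSpace} (T : H -> H) : Prop :=
  is_linear T /\ forall h : H, norm (T h) <= norm h.

Definition closed_subspace {H : HilbertSpace} (M : H -> Prop) : Prop :=
  M zero /\
  (forall x y : H, M x -> M y -> M (plus x y)) /\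
  (forall (c : C) (x : H), M x -> M (scal c x)) /\
  closed M.

Definition orthogonal {H : HilbertSpace} (M : H -> Prop) (x : H) : Prop :=
  forall y : H, M y -> inner x y = RtoC 0.

Definition invariant {H : HilbertSpace} (T : H -> H) (M : H -> Prop) : Prop :=
  forall x : H, M x -> M (T x).

Definition reducing {H : HilbertSpace} (T : H -> H) (M : H -> Prop) : Prop :=
  closed_subspace M /\ invariant T M /\ invariant T (orthogonal M).

(* For M invariant under a linear T: T maps M isometrically onto M. *)
Definition unitary_on {H : HilbertSpace} (T : H -> H) (M : H -> Prop) : Prop :=
  (forall x : H, M x -> norm (T x) = norm x) /\
  (forall y : H, M y -> exists x : H, M x /\ T x = y).

Definition completely_non_unitary {H : HilbertSpace} (T : H -> H) : Prop :=
  forall M : H -> Prop, reducing T M -> unitary_on T M ->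
    forall x : H, M x -> x = zero.

(* H^infinity; the values of u off the open unit disc are irrelevant. *)
Definition Hinfty (u : C -> C) : Prop :=
  (forall z : C, Cmod z < 1 ->
     ex_derive (K := C_AbsRing) (V := C_NormedModule) u z) /\
  exists B : R, forall z : C, Cmod z < 1 -> Cmod (u z) <= B.

Definition taylor_coefficients (u : C -> C) (a : nat -> C) : Prop :=
  forall z : C, Cmod z < 1 ->
    is_pseries (K := C_AbsRing) (V := C_NormedModule) a z (u z).

(* The Sz.-Nagy--Foias functional calculus, as a relation "u(T) = A": with
   u = sum_n a_n z^n and u_r(z) = u(rz), the operator u(T) is the strong limit
   of u_r(T) = sum_n a_n r^n T^n as r -> 1-.  [U r] is u_r(T). *)
Definition functional_calculus {H : HilbertSpace}
    (T : H -> H) (u : C -> C) (A : H -> H) : Prop :=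
  exists (a : nat -> C) (U : R -> H -> H),
    taylor_coefficients u a /\
    (forall (r : R) (h : H), 0 <= r < 1 ->
       is_pseries (fun n => scal (a n) (Nat.iter n T h) : H) (RtoC r) (U r h)) /\
    (forall h : H, filterlim (fun r => U r h) (at_left 1) (locally (A h))).

Definition class_C0 {H : HilbertSpace} (T : H -> H) : Prop :=
  contraction T /\ completely_non_unitary T /\
  exists u : C -> C, Hinfty u /\
    (exists z : C, Cmod z < 1 /\ u z <> RtoC 0) /\
    functional_calculus T u (fun _ => zero).

Definition spectrum {H : HilbertSpace} (T : H -> H) (lambda : C) : Prop :=
  ~ exists S : H -> H, is_linear S /\
      (forall h : H, minus (T (S h)) (scal lambda (S h)) = h) /\
      (forall h : H, S (minus (T h) (scal lambda h)) = h).

(* Main.v *)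
Require Import Defs.
From Stdlib Require Import Reals Lra Lia ssreflect.
From Coquelicot Require Import Coquelicot.
From Stdlib Require Import List Classical FunctionalExtensionality.
Import ListNotations.

Open Scope R_scope.

(** A point [c] of the spectrum with [|c| > 1] is excluded by the Neumann series.
    Let [|c| < 1], [N = T - c] and [u(T) = 0] with [u <> 0].

    The function [u] has a finite order [k] at [c] ([finite_order]), so
    [u = b^k v] with [b] the Blaschke factor at [c], [v] bounded and
    [v(c) <> 0]. Writing [v = v(c) + (z - c) g], the operators
    [E = - g(rT) / v(c)] commute with [T], are bounded uniformly in [r] by von
    Neumann's inequality, and [N^k (1 - N E)] tends strongly to 0 as [r] tends to
    1 ([approximate_inverses]). By itself this splits the space: [N^k E^k]
    converges strongly, and one minus its limit is a bounded projection [P] that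
    commutes with [T] and satisfies [N^k P = 0]. If [P = 0], then [N] is
    invertible ([invertible_of_trivial_kernel]). The operator [v(T)] itself never
    appears: power series are only evaluated at [rT] with [r < 1], where they
    converge in norm.

    The projection [P] is itself an extension class: for [U] the matrix
    [T P; 0 T], the operator [p(U)] has the corner [p'(T) P], which involves only
    finitely many derivatives of [p] at [c] because [N^k P = 0], and those are
    bounded by [sup |p|] ([upper_triangular_polynomially_bounded]). If
    [Ext^1(T, T) = 0], then [P = T L - L T = N L - L N], so on the range of [P] the
    identity is a commutator with a nilpotent; this forces [P = 0]
    ([commutator_with_nilpotent]) and [c] is not in the spectrum.

    Two inequalities carry the estimates. Von Neumann's inequality is proved from
    the identity [|h|^2 = sum_j (|T^j h|^2 - |T^(j+1) h|^2)] for strict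
    contractions and Parseval's identity over roots of unity
    ([von_neumann_poly]). Applied to scalars it is the maximum principle, which
    gives Schwarz's lemma ([schwarz]): dividing by a Blaschke factor does not
    increase the supremum. *)

(** * Linear algebra over the complex numbers *)

(** Syntax of vector expressions: [VAtom i] stands for the [i]-th vector of an
    environment. *)
Inductive vexpr :=
| VAtom (i : nat) | VZero | VPlus (e f : vexpr) | VOpp (e : vexpr)
| VMinus (e f : vexpr) | VScal (c : C) (e : vexpr).

Fixpoint vcoef (e : vexpr) (i : nat) : C :=
  match e with
  | VAtom j => if Nat.eqb i j then RtoC 1 else RtoC 0
  | VZero => RtoC 0
  | VPlus e f => Cplus (vcoef e i) (vcoef f i)
  | VOpp e => Copp (vcoef e i)
  | VMinus e f => Cminus (vcoef e i) (vcoef f i)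
  | VScal c e => Cmult c (vcoef e i)
  end.

Section ModuleEquations.
Context {V : NormedModule C_AbsRing}.

Fixpoint vdenote (l : list V) (e : vexpr) : V :=
  match e with
  | VAtom i => nth i l zero
  | VZero => zero
  | VPlus e f => plus (vdenote l e) (vdenote l f)
  | VOpp e => opp (vdenote l e)
  | VMinus e f => minus (vdenote l e) (vdenote l f)
  | VScal c e => scal c (vdenote l e)
  end.

Fixpoint lincomb (l : list V) (f : nat -> C) : V :=
  match l with
  | nil => zero
  | x :: t => plus (scal (f 0%nat) x) (lincomb t (fun i => f (S i)))
  end.

Lemma lincomb_0 l : lincomb l (fun _ => RtoC 0) = zero.
Proof.
elim: l => [//|x t IH] /=; rewrite IH plus_zero_r.
exact: (scal_zero_l (K := C_AbsRing) x).
Qed.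

Lemma lincomb_plus l f g :
  lincomb l (fun i => Cplus (f i) (g i)) = plus (lincomb l f) (lincomb l g).
Proof.
elim: l f g => [|x t IH] f g /=; first by rewrite plus_zero_l.
rewrite IH (_ : scal (Cplus _ _) x = plus (scal (f 0%nat) x) (scal (g 0%nat) x)).
  by rewrite -!plus_assoc; congr (plus _ _); rewrite !plus_assoc;
     congr (plus _ _); rewrite plus_comm.
exact: (scal_distr_r (K := C_AbsRing)).
Qed.

Lemma lincomb_scal l c f :
  lincomb l (fun i => Cmult c (f i)) = scal c (lincomb l f).
Proof.
elim: l f => [|x t IH] f /=; first by rewrite scal_zero_r.
rewrite IH scal_distr_l; congr (plus _ _).
by rewrite (scal_assoc c (f 0%nat)).
Qed.

Lemma lincomb_opp l f :
  lincomb l (fun i => Copp (f i)) = opp (lincomb l f).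
Proof.
have -> : (fun i => Copp (f i)) = (fun i => Cmult (Copp (RtoC 1)) (f i)).
  by apply: functional_extensionality => i; ring.
by rewrite lincomb_scal (scal_opp_l (K := C_AbsRing)) (scal_one (K := C_AbsRing)).
Qed.

Lemma vdenote_lincomb l e : vdenote l e = lincomb l (vcoef e).
Proof.
elim: e => /= [i| |e -> f ->|e ->|e -> f ->|c e ->].
- elim: l i => [|x t IH] [|i] //=.
  + rewrite lincomb_0 plus_zero_r.
    by rewrite (scal_one (K := C_AbsRing)).
  + by rewrite IH (scal_zero_l (K := C_AbsRing)) plus_zero_l.
- by rewrite lincomb_0.
- by rewrite lincomb_plus.
- by rewrite lincomb_opp.
- by rewrite /minus -lincomb_opp -lincomb_plus.
- by rewrite lincomb_scal.
Qed.

Fixpoint same_coefs (l : list V) (f g : nat -> C) : Prop :=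
  match l with
  | nil => True
  | _ :: t => f 0%nat = g 0%nat /\ same_coefs t (fun i => f (S i)) (fun i => g (S i))
  end.

(** Two linear combinations of the same vectors agree as soon as their
    coefficients do: an equation in a module becomes equations between complex
    numbers, which [ring] and [field] solve. *)
Lemma vdenote_eq l e f :
  same_coefs l (vcoef e) (vcoef f) -> vdenote l e = vdenote l f.
Proof.
rewrite !vdenote_lincomb.
move: (vcoef e) (vcoef f); elim: l => [//|x t IH] p q /= [-> /IH ->] //.
Qed.
End ModuleEquations.

(* Atoms are compared up to conversion: the carrier of a Hilbert space is
   reached through several chains of coercions. *)
Ltac vindex x l :=
  match l with
  | ?y :: _ => let _ := match goal with _ => unify x y end in constr:(0%nat)
  | _ :: ?t => let n := vindex x t in constr:(S n)
  end.
Ltac vadd x l :=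
  match l with
  | _ => let _ := vindex x l in l
  | _ => constr:(x :: l)
  end.
Ltac vatoms t l :=
  lazymatch t with
  | plus ?a ?b => let l := vatoms a l in vatoms b l
  | minus ?a ?b => let l := vatoms a l in vatoms b l
  | opp ?a => vatoms a l
  | scal _ ?a => vatoms a l
  | zero => l
  | _ => vadd t l
  end.
Ltac vreify t l :=
  lazymatch t with
  | plus ?a ?b => let a := vreify a l in let b := vreify b l in constr:(VPlus a b)
  | minus ?a ?b => let a := vreify a l in let b := vreify b l in constr:(VMinus a b)
  | opp ?a => let a := vreify a l in constr:(VOpp a)
  | scal ?c ?a => let a := vreify a l in constr:(VScal c a)
  | zero => constr:(VZero)
  | _ => let i := vindex t l in constr:(VAtom i)
  end.
(** [module_eq_with tac] proves an equation between vectors of a complex normed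
    module by comparing coefficients with [tac]. *)
Ltac module_eq_with tac :=
  match goal with
  | |- @eq ?T ?a ?b =>
    let l := vatoms a (@nil T) in
    let l := vatoms b l in
    let ea := vreify a l in
    let eb := vreify b l in
    refine (vdenote_eq l ea eb _);
    cbv [same_coefs vcoef Nat.eqb]; repeat split; tac
  end.
Ltac module_eq := module_eq_with ltac:(ring).

(** Normed modules only require [<=]; over a field the inverse scalar gives the
    converse. *)
Lemma norm_scal_C {V : NormedModule C_AbsRing} (c : C) (x : V) :
  norm (scal c x) = Cmod c * norm x.
Proof.
apply: Rle_antisym; first exact: (norm_scal (K := C_AbsRing)).
case: (classic (c = RtoC 0)) => [->|c0].
  rewrite Cmod_0 Rmult_0_l; exact: norm_ge_0.
have cp : 0 < Cmod c by apply/Cmod_gt_0.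
have -> : x = scal (Cinv c) (scal c x) by module_eq_with ltac:(field; exact c0).
have := norm_scal (K := C_AbsRing) (V := V) (Cinv c) (scal c x).
rewrite (_ : abs (Cinv c) = / Cmod c); last exact: Cmod_inv.
move=> H; apply: Rle_trans (Rmult_le_compat_l _ _ _ (Rlt_le _ _ cp) H) _.
rewrite -Rmult_assoc Rinv_r; last lra.
rewrite (_ : scal c (scal (Cinv c) (scal c x)) = scal c x); first lra.
module_eq_with ltac:(field; exact c0).
Qed.

Lemma norm_minus_sym {V : NormedModule C_AbsRing} (x y : V) :
  norm (minus x y) = norm (minus y x).
Proof. by rewrite -norm_opp; congr norm; module_eq. Qed.

Lemma norm_minus_triangle {V : NormedModule C_AbsRing} (x y : V) :
  norm (minus x y) <= norm x + norm y.
Proof.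
by rewrite /minus -(norm_opp y); apply: norm_triangle.
Qed.

Lemma norm_dist_triangle {V : NormedModule C_AbsRing} (x y z : V) :
  norm (minus x z) <= norm (minus x y) + norm (minus y z).
Proof.
have -> : minus x z = plus (minus x y) (minus y z) by module_eq.
exact: norm_triangle.
Qed.

Lemma minus_zero_eq {V : NormedModule C_AbsRing} (x y : V) :
  minus x y = zero -> x = y.
Proof.
move=> H; have -> : x = plus (minus x y) y by module_eq.
by rewrite H plus_zero_l.
Qed.

Lemma Cmod_dist_ge (x y : C) : Cmod x - Cmod y <= Cmod (Cminus x y).
Proof.
have := Cmod_triangle (Cminus x y) y.
rewrite (_ : Cplus (Cminus x y) y = x); first lra.
by ring.
Qed.

(** * Bounded operators *)

Section LinearMaps.
Context {V W : NormedModule C_AbsRing} (T : V -> W) (HT : is_linear T).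

Lemma linear_sum_n f n : T (sum_n f n) = sum_n (fun k => T (f k)) n.
Proof.
elim: n => [|n IH]; first by rewrite !sum_O.
by rewrite !sum_Sn (linear_plus T HT) IH.
Qed.

Lemma linear_limit f l :
  filterlim f eventually (locally l) ->
  filterlim (fun n => T (f n)) eventually (locally (T l)).
Proof.
by move=> Hf; apply: filterlim_comp Hf _; apply: linear_cont.
Qed.

Lemma linear_series f l : is_series f l -> is_series (fun k => T (f k)) (T l).
Proof.
move=> Hf; rewrite /is_series.
apply: (filterlim_ext (fun n => T (sum_n f n))) => [n|]; first exact: linear_sum_n.
exact: linear_limit.
Qed.
End LinearMaps.

Definition op_bound {V W : NormedModule C_AbsRing} (T : V -> W) (r : R) :=
  is_linear T /\ 0 <= r /\ forall x, norm (T x) <= r * norm x.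

Lemma op_bound_intro {V W : NormedModule C_AbsRing} (T : V -> W) r :
  (forall x y, T (plus x y) = plus (T x) (T y)) ->
  (forall (c : C) x, T (scal c x) = scal c (T x)) ->
  0 <= r -> (forall x, norm (T x) <= r * norm x) -> op_bound T r.
Proof.
move=> Hp Hs Hr Hb; split=> //; split=> //.
exists (r + 1); split; first lra.
by move=> x; have := Hb x; have := norm_ge_0 x; nra.
Qed.

Lemma op_bound_exists {V W : NormedModule C_AbsRing} (T : V -> W) :
  is_linear T -> exists r, op_bound T r.
Proof.
move=> HT; case: (linear_norm T HT) => M [HM Hb].
by exists M; split=> //; split=> //; lra.
Qed.

Lemma op_bound_comp {U V W : NormedModule C_AbsRing} (S : U -> V) (T : V -> W) s t :
  op_bound S s -> op_bound T t -> op_bound (fun x => T (S x)) (t * s).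
Proof.
move=> [HS [Hs Bs]] [HT [Ht Bt]].
apply: op_bound_intro => [x y|c x||x].
- by rewrite (linear_plus S HS) (linear_plus T HT).
- by rewrite (linear_scal S HS) (linear_scal T HT).
- exact: Rmult_le_pos.
- by apply: Rle_trans (Bt _) _; rewrite Rmult_assoc; apply: Rmult_le_compat_l.
Qed.

Lemma op_bound_scal {V W : NormedModule C_AbsRing} (T : V -> W) t c :
  op_bound T t -> op_bound (fun x => scal c (T x)) (Cmod c * t).
Proof.
move=> [HT [Ht Bt]].
apply: op_bound_intro => [x y|d x||x].
- by rewrite (linear_plus T HT); module_eq.
- by rewrite (linear_scal T HT); module_eq.
- by apply: Rmult_le_pos => //; apply: Cmod_ge_0.
- rewrite norm_scal_C Rmult_assoc.
  by apply: Rmult_le_compat_l => //; apply: Cmod_ge_0.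
Qed.

Lemma op_bound_plus {V W : NormedModule C_AbsRing} (S T : V -> W) s t :
  op_bound S s -> op_bound T t -> op_bound (fun x => plus (S x) (T x)) (s + t).
Proof.
move=> [HS [Hs Bs]] [HT [Ht Bt]].
apply: op_bound_intro => [x y|c x||x].
- by rewrite (linear_plus S HS) (linear_plus T HT); module_eq.
- by rewrite (linear_scal S HS) (linear_scal T HT); module_eq.
- lra.
- have := norm_triangle (S x) (T x); have := Bs x; have := Bt x; lra.
Qed.

Lemma op_bound_id {V : NormedModule C_AbsRing} : op_bound (fun x : V => x) 1.
Proof. by apply: op_bound_intro => // [|x]; lra. Qed.

Lemma op_bound_iter {V : NormedModule C_AbsRing} (T : V -> V) t n :
  op_bound T t -> op_bound (Nat.iter n T) (t ^ n).
Proof.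
move=> HT; elim: n => [|n IH]; first exact: op_bound_id.
exact: op_bound_comp IH HT.
Qed.

Definition affine {V : NormedModule C_AbsRing} (a b : C) (T : V -> V) (x : V) : V :=
  plus (scal a x) (scal b (T x)).

Lemma op_bound_affine {V : NormedModule C_AbsRing} (T : V -> V) t a b :
  op_bound T t -> op_bound (affine a b T) (Cmod a * 1 + Cmod b * t).
Proof.
move=> HT; apply: op_bound_plus; last exact: op_bound_scal.
exact: (op_bound_scal (fun x => x)) op_bound_id.
Qed.

Definition commutes {V : Type} (S T : V -> V) := forall x, S (T x) = T (S x).

Lemma commutes_sym {V : Type} (S T : V -> V) : commutes S T -> commutes T S.
Proof. by move=> H x; rewrite H. Qed.

Lemma commutes_iter {V : Type} (S T : V -> V) n :
  commutes S T -> commutes S (Nat.iter n T).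
Proof. by move=> H; elim: n => [//|n IH] x /=; rewrite H IH. Qed.

Lemma commutes_affine {V : NormedModule C_AbsRing} (S T : V -> V) a b :
  is_linear S -> commutes S T -> commutes S (affine a b T).
Proof.
move=> HS H x; rewrite /affine (linear_plus S HS) !(linear_scal S HS).
by rewrite H.
Qed.

(** * Series and limits in normed modules *)

Lemma limit_norm {V : NormedModule C_AbsRing} (f : nat -> V) l :
  filterlim f eventually (locally l) ->
  is_lim_seq (fun n => norm (f n)) (norm l).
Proof.
by move=> Hf; apply: filterlim_comp Hf _; apply: filterlim_norm.
Qed.

Lemma limit_unique {V : NormedModule C_AbsRing} (f : nat -> V) (x y : V) :
  filterlim f eventually (locally x) -> filterlim f eventually (locally y) -> x = y.
Proof.
move=> Hx Hy.
exact: (filterlim_locally_unique (F := eventually) f x y Hx Hy).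
Qed.

Lemma limit_dist {V : NormedModule C_AbsRing} (f : nat -> V) l :
  filterlim f eventually (locally l) <->
  is_lim_seq (fun n => norm (minus (f n) l)) 0.
Proof.
split=> [Hf|Hf].
- rewrite -(norm_zero (V := V)); apply: limit_norm.
  have -> : (zero : V) = minus l l by module_eq.
  refine (filterlim_comp_2 f (fun n => opp l) (fun x y => plus x y) Hf _ _).
    exact: filterlim_const.
  exact: filterlim_plus.
- apply/filterlim_locally => eps.
  have := proj2 (is_lim_seq_spec _ _) Hf eps; apply: filter_imp => n Hn.
  apply: (norm_compat1 (K := C_AbsRing)).
  move: Hn; rewrite Rminus_0_r Rabs_pos_eq //; exact: norm_ge_0.
Qed.

Lemma series_norm_le {V : NormedModule C_AbsRing} (x : nat -> V) (b : nat -> R) l (B : R) :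
  is_series x l -> is_series b B -> (forall n, norm (x n) <= b n) -> norm l <= B.
Proof.
move=> Hx Hb Hle.
have Hl : Rbar_le (norm l) B; last exact: Hl.
refine (is_lim_seq_le _ _ _ _ _ (limit_norm _ _ Hx)
  (Hb : is_lim_seq (sum_n b) B)) => n.
apply: Rle_trans (norm_sum_n_m _ _ _) _.
exact: sum_n_m_le.
Qed.

Lemma geom_series q M : 0 <= q < 1 -> is_series (fun n => M * q ^ n) (M * / (1 - q)).
Proof.
move=> Hq; apply: (is_series_scal_l (K := R_AbsRing) (V := R_NormedModule)).
by apply: is_series_geom; rewrite Rabs_pos_eq; lra.
Qed.

Lemma geom_ex_series {V : CompleteNormedModule C_AbsRing} (x : nat -> V) M q :
  0 <= q < 1 -> (forall n, norm (x n) <= M * q ^ n) -> ex_series x.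
Proof.
move=> Hq Hx; apply: ex_series_le Hx _.
by eexists; apply: geom_series.
Qed.

(** * Power series with bounded growth, evaluated at an operator *)

(** The coefficients of a power series with radius of convergence at least 1. *)
Definition disc_series (a : nat -> C) : Prop :=
  forall R, 0 < R < 1 -> exists M, forall n, Cmod (a n) * R ^ n <= M.

Lemma disc_series_near (a : nat -> C) r0 :
  r0 < 1 -> (forall R, r0 < R < 1 -> 0 < R -> exists M, forall n, Cmod (a n) * R ^ n <= M) ->
  disc_series a.
Proof.
move=> Hr0 H R HR.
have HM := Rmax_l R r0; have HM' := Rmax_r R r0.
have HM1 : Rmax R r0 < 1 by apply: Rmax_lub_lt; lra.
case: (H ((Rmax R r0 + 1) / 2)); try lra.
move=> M HMn; exists M => n; apply: Rle_trans (HMn n).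
apply: Rmult_le_compat_l; first exact: Cmod_ge_0.
by apply: pow_incr; lra.
Qed.

Section OpSeries.
Context {V : CompleteNormedModule C_AbsRing}.

(** [a(T) h], meaningful when the series converges. *)
Definition opseries (a : nat -> C) (T : V -> V) (h : V) : V :=
  iota (is_series (fun n => scal (a n) (Nat.iter n T h))).

Lemma opseries_unique a T h l :
  is_series (fun n => scal (a n) (Nat.iter n T h)) l -> opseries a T h = l.
Proof.
move=> Hl; apply: iota_unique => // y Hy.
exact: (filterlim_locally_unique _ _ _ Hy Hl).
Qed.

Context (T : V -> V) (t : R) (HT : op_bound T t) (Ht : t < 1).

Lemma opseries_correct a h :
  disc_series a -> is_series (fun n => scal (a n) (Nat.iter n T h)) (opseries a T h).
Proof using HT Ht.
move=> Ha.
have t0 : 0 <= t by case: HT => _ [].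
case: (Ha ((t + 1) / 2)); first lra.
move=> M HM.
have [l Hl] : ex_series (fun n => scal (a n) (Nat.iter n T h)).
  apply: (geom_ex_series _ (M * norm h) (t / ((t + 1) / 2))).
    split; first by apply: Rmult_le_pos => //; apply/Rlt_le/Rinv_0_lt_compat; lra.
    by apply/Rlt_div_l; lra.
  move=> n; rewrite norm_scal_C.
  case: (op_bound_iter T t n HT) => _ [_ /(_ h) Hn].
  have Hp : 0 < ((t + 1) / 2) ^ n by apply: pow_lt; lra.
  have Htn : 0 <= t ^ n by apply: pow_le.
  rewrite /Rdiv Rpow_mult_distr pow_inv /=.
  apply: Rle_trans (Rmult_le_compat_l _ _ _ (Cmod_ge_0 _) Hn) _.
  have Ha' : Cmod (a n) <= M * / ((t + 1) / 2) ^ n by apply/Rle_div_r => //; apply: HM.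
  have := Rmult_le_compat_r (t ^ n * norm h) _ _ _ Ha'.
  have := Rmult_le_pos _ _ Htn (norm_ge_0 h).
  by rewrite /Rdiv; lra.
by rewrite (opseries_unique _ _ _ _ Hl).
Qed.

Lemma opseries_plus a x y :
  disc_series a -> opseries a T (plus x y) = plus (opseries a T x) (opseries a T y).
Proof using HT Ht.
move=> Ha; apply: opseries_unique.
apply: is_series_ext (is_series_plus _ _ _ _ (opseries_correct a x Ha) (opseries_correct a y Ha)) => n.
by case: (op_bound_iter T t n HT) => HL _; rewrite (linear_plus _ HL); module_eq.
Qed.

Lemma opseries_scal a (c : C) x :
  disc_series a -> opseries a T (scal c x) = scal c (opseries a T x).
Proof using HT Ht.
move=> Ha; apply: opseries_unique.
apply: is_series_ext (is_series_scal c _ _ (opseries_correct a x Ha)) => n.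
by case: (op_bound_iter T t n HT) => HL _; rewrite (linear_scal _ HL); module_eq.
Qed.

Lemma opseries_commutes a S :
  disc_series a -> is_linear S -> commutes S T -> commutes (opseries a T) S.
Proof using HT Ht.
move=> Ha HS HC x; apply: opseries_unique.
apply: is_series_ext (linear_series S HS _ _ (opseries_correct a x Ha)) => n.
by rewrite (linear_scal S HS) (commutes_iter _ _ n HC).
Qed.
End OpSeries.

(** Coefficients of [(p + q z) f(z)], where [a] are those of [f]. *)
Definition coef_affine (p q : C) (a : nat -> C) (n : nat) : C :=
  match n with
  | O => Cmult p (a O)
  | S m => Cplus (Cmult p (a n)) (Cmult q (a m))
  end.

Lemma disc_series_affine p q a : disc_series a -> disc_series (coef_affine p q a).
Proof.
move=> Ha R HR; case: (Ha R HR) => M HM.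
have M0 : 0 <= M by have := HM 0%nat; have := Cmod_ge_0 (a 0%nat) => /=; lra.
have Hp := Cmod_ge_0 p; have Hq := Cmod_ge_0 q.
exists (Cmod p * M + Cmod q * M) => -[|n] /=.
  rewrite Cmod_mult; have := HM 0%nat => /=; nra.
apply: Rle_trans (Rmult_le_compat_r _ _ _ _ (Cmod_triangle _ _)) _.
  by apply: Rmult_le_pos; [lra|apply: pow_le; lra].
rewrite !Cmod_mult; have := HM n; have := HM (S n) => /= H1 H2.
have H3 : 0 <= Cmod (a n) * R ^ n.
  by apply: Rmult_le_pos; [apply: Cmod_ge_0|apply: pow_le; lra].
have := Rmult_le_compat_l _ _ _ Hp H1.
have := Rmult_le_compat_l _ _ _ Hq H2.
have : Cmod q * (R * (Cmod (a n) * R ^ n)) <= Cmod q * (1 * (Cmod (a n) * R ^ n)).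
  by apply: Rmult_le_compat_l => //; apply: Rmult_le_compat_r => //; lra.
lra.
Qed.

Lemma opseries_affine {V : CompleteNormedModule C_AbsRing} (T : V -> V) t p q a h :
  op_bound T t -> t < 1 -> disc_series a ->
  opseries (coef_affine p q a) T h = affine p q T (opseries a T h).
Proof.
move=> HT Ht Ha; apply: opseries_unique.
have Hs := opseries_correct T t HT Ht a h Ha.
case: (HT) => HL _.
have Hq : is_series (fun n => match n with O => zero | S m => T (scal (a m) (Nat.iter m T h)) end)
    (T (opseries a T h)).
  apply: is_series_decr_1.
  by rewrite opp_zero plus_zero_r; apply: linear_series.
have := is_series_plus _ _ _ _ (is_series_scal p _ _ Hs) (is_series_scal q _ _ Hq).
apply: is_series_ext => -[|n] /=; first by module_eq.
by rewrite (linear_scal T HL); module_eq.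
Qed.

Definition coef_iter p q k a := Nat.iter k (coef_affine p q) a.

Lemma disc_series_iter p q k a : disc_series a -> disc_series (coef_iter p q k a).
Proof. by move=> Ha; elim: k => [//|k IH]; apply: disc_series_affine. Qed.

Lemma opseries_iter {V : CompleteNormedModule C_AbsRing} (T : V -> V) t p q k a h :
  op_bound T t -> t < 1 -> disc_series a ->
  opseries (coef_iter p q k a) T h = Nat.iter k (affine p q T) (opseries a T h).
Proof.
move=> HT Ht Ha; elim: k => [//|k IH] /=; rewrite -IH.
apply: opseries_affine HT Ht _; exact: disc_series_iter.
Qed.

Lemma coef_affine_comm p q r s a :
  coef_affine p q (coef_affine r s a) = coef_affine r s (coef_affine p q a).
Proof. by apply: functional_extensionality => -[|[|n]] /=; ring. Qed.

(* Sums in [C] are stated in its underlying monoid, which [ring] does not see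
   through. *)
Ltac C_ring := match goal with |- @eq _ ?a ?b => change (@eq C a b) end; ring.

(** * Fourier analysis on a finite cyclic group *)

Lemma RtoC_sum_n (f : nat -> R) n :
  RtoC (sum_n f n) = sum_n (G := C_AbelianMonoid) (fun k => RtoC (f k)) n.
Proof.
elim: n => [|n IH]; first by rewrite !sum_O.
by rewrite !sum_Sn -IH; apply: RtoC_plus.
Qed.

Lemma Csum_mult_l (a : C) (u : nat -> C) n :
  Cmult a (sum_n (G := C_AbelianMonoid) u n)
  = sum_n (G := C_AbelianMonoid) (fun k => Cmult a (u k)) n.
Proof. symmetry; exact: (sum_n_mult_l (K := C_Ring)). Qed.

Lemma sum_n_kronecker {G : AbelianMonoid} (f : nat -> G) n l :
  (l <= n)%nat -> sum_n (fun m => if Nat.eqb l m then f m else zero) n = f l.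
Proof.
have H0 k : (k < l)%nat -> sum_n (fun m => if Nat.eqb l m then f m else zero) k = zero.
  elim: k => [|k IH] Hk.
    by rewrite sum_O; case: Nat.eqb_spec => //; lia.
  rewrite sum_Sn IH; last lia.
  by case: Nat.eqb_spec; [lia|rewrite plus_zero_l].
elim: n => [|n IH] Hl.
  by rewrite sum_O; case: Nat.eqb_spec => [->|] //; lia.
rewrite sum_Sn; case: Nat.eqb_spec => [E|Hne].
  by rewrite H0; [rewrite plus_zero_l E|lia].
by rewrite IH; [rewrite plus_zero_r|lia].
Qed.

Lemma geometric_sum (z : C) n :
  Cmult (Cminus z 1) (sum_n (G := C_AbelianMonoid) (fun j => Cpow z j) n) = Cminus (Cpow z (S n)) 1.
Proof.
elim: n => [|n IH]; first by rewrite sum_O /=; ring.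
rewrite sum_Sn (_ : plus _ _ = Cplus (sum_n (G := C_AbelianMonoid) (fun j => Cpow z j) n) (Cpow z (S n))) //.
by rewrite Cmult_plus_distr_l IH /=; ring.
Qed.

(** Its order is [n + 1], the number of terms of a sum [sum_n _ n]. *)
Definition root_of_unity (n : nat) : C :=
  let x := 2 * PI / INR (S n) in (cos x, sin x).

Section RootsOfUnity.
Variable n : nat.
Let w := root_of_unity n.

Lemma root_of_unity_pow k :
  Cpow w k = (cos (INR k * (2 * PI / INR (S n))), sin (INR k * (2 * PI / INR (S n)))).
Proof.
elim: k => [|k IH]; first by rewrite /= Rmult_0_l cos_0 sin_0.
rewrite Cpow_S IH (S_INR k) Rmult_plus_distr_r Rmult_1_l.
by rewrite cos_plus sin_plus /w /root_of_unity /Cmult /=; congr pair; ring.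
Qed.

Lemma root_of_unity_order : Cpow w (S n) = RtoC 1.
Proof.
rewrite root_of_unity_pow.
have -> : INR (S n) * (2 * PI / INR (S n)) = 2 * PI.
  by field; apply: not_0_INR.
by rewrite cos_2PI sin_2PI.
Qed.

Lemma root_of_unity_primitive d : (0 < d <= n)%nat -> Cpow w d <> RtoC 1.
Proof.
move=> Hd; rewrite root_of_unity_pow => -[] Hc _.
have Hn : 0 < INR (S n) by apply: lt_0_INR; lia.
have Hd0 : 0 < INR d by apply: lt_0_INR; lia.
have Hdn : INR d < INR (S n) by apply: lt_INR; lia.
have Hpi := PI_RGT_0.
have E : INR d * (2 * PI / INR (S n)) = 2 * (PI * (INR d / INR (S n))) by field; lra.
have Hq : 0 < INR d / INR (S n) < 1.
  by split; [apply: Rdiv_lt_0_compat|apply/Rlt_div_l => //; lra].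
have Hs : 0 < sin (PI * (INR d / INR (S n))) by apply: sin_gt_0; nra.
by move: Hc; rewrite E cos_2a_sin; nra.
Qed.

Lemma Cmod_root_of_unity k : Cmod (Cpow w k) = 1.
Proof.
rewrite root_of_unity_pow /Cmod /=.
set x := INR k * _.
rewrite (_ : _ + _ = 1) ?sqrt_1 //.
by have := sin2_cos2 x; rewrite /Rsqr; lra.
Qed.

Lemma root_of_unity_conj k : Cmult (Cpow w k) (Cconj (Cpow w k)) = RtoC 1.
Proof. by rewrite -Cmod2_conj Cmod_root_of_unity pow1. Qed.

Lemma root_of_unity_inj l m :
  (l <= n)%nat -> (m <= n)%nat -> Cpow w l = Cpow w m -> l = m.
Proof.
wlog lm : l m / (l <= m)%nat.
  move=> H Hl Hm E; case: (Nat.le_ge_cases l m) => ?; first exact: H.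
  by symmetry; apply: H.
move=> Hl Hm E; case: (Nat.eq_dec l m) => // Hne.
case: (root_of_unity_primitive (m - l)); first lia.
have Em : Cpow w m = Cmult (Cpow w (m - l)) (Cpow w l).
  by rewrite -Cpow_add_r; congr Cpow; lia.
rewrite -[LHS]Cmult_1_r -[in LHS](root_of_unity_conj l) Cmult_assoc -Em -E.
exact: root_of_unity_conj.
Qed.

Lemma characters_orthogonal l m : (l <= n)%nat -> (m <= n)%nat ->
  sum_n (G := C_AbelianMonoid) (fun j => Cmult (Cpow w (j * l)) (Cconj (Cpow w (j * m)))) n
  = if Nat.eqb l m then RtoC (INR (S n)) else RtoC 0.
Proof.
move=> Hl Hm; case: Nat.eqb_spec => [<-|Hne].
  rewrite (sum_n_ext _ (fun _ => RtoC 1)) => [|j]; last exact: root_of_unity_conj.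
  by rewrite -RtoC_sum_n sum_n_const Rmult_1_r.
set z := Cmult (Cpow w l) (Cconj (Cpow w m)).
rewrite (sum_n_ext _ (fun j => Cpow z j)) => [|j]; last first.
  rewrite /z Cpow_mult_l -Cpow_conj -!Cpow_mult_r.
  by rewrite (Nat.mul_comm l) (Nat.mul_comm m).
have Hz : Cpow z (S n) = RtoC 1.
  rewrite /z Cpow_mult_l -Cpow_conj -!Cpow_mult_r (Nat.mul_comm l) (Nat.mul_comm m).
  rewrite !Cpow_mult_r root_of_unity_order !Cpow_1_l Cmult_1_l.
  by rewrite /Cconj /RtoC /= Ropp_0.
have Hz1 : Cminus z 1 <> RtoC 0.
  move=> E; apply: Hne; apply: root_of_unity_inj => //.
  have {}E : z = RtoC 1 by rewrite -(Cplus_0_l 1) -E; ring.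
  rewrite -[LHS]Cmult_1_r -[in LHS](root_of_unity_conj m).
  rewrite (_ : Cmult _ _ = Cmult z (Cpow w m)); last by rewrite /z; ring.
  by rewrite E Cmult_1_l.
have := geometric_sum z n; rewrite Hz.
rewrite (_ : Cminus 1 1 = RtoC 0); last by ring.
move=> E; have := f_equal (Cmult (Cinv (Cminus z 1))) E.
rewrite Cmult_assoc Cinv_l // Cmult_1_l Cmult_0_r.
exact.
Qed.

Section Transform.
Context {V : NormedModule C_AbsRing}.

(** The normalization is carried by the inverse transform, so that an orbit is
    [fourier] of a sequence on which multipliers act. *)
Definition fourier (Z : nat -> V) (j : nat) : V :=
  sum_n (fun l => scal (Cpow w (j * l)) (Z l)) n.

Definition fourier_inv (x : nat -> V) (l : nat) : V :=
  scal (Cinv (RtoC (INR (S n))))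
    (sum_n (fun j => scal (Cconj (Cpow w (l * j))) (x j)) n).

Lemma sum_n_scal_r (f : nat -> C) (x : V) m :
  sum_n (fun k => scal (f k) x) m = scal (sum_n (G := C_AbelianMonoid) f m) x.
Proof.
elim: m => [|m IH]; first by rewrite !sum_O.
rewrite !sum_Sn IH; symmetry; exact: (scal_distr_r (K := C_AbsRing)).
Qed.

Lemma fourierK x j : (j <= n)%nat -> fourier (fourier_inv x) j = x j.
Proof.
move=> Hj; rewrite /fourier /fourier_inv.
have Hn : RtoC (INR (S n)) <> RtoC 0.
  by move=> /RtoC_inj; apply: not_0_INR.
rewrite (sum_n_ext _ (fun l => sum_n (fun m =>
  scal (Cmult (Cinv (RtoC (INR (S n)))) (Cmult (Cpow w (l * j)) (Cconj (Cpow w (l * m))))) (x m)) n)); last first.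
  move=> l; rewrite -!(sum_n_scal_l (K := C_Ring)); apply: sum_n_ext => m.
  by rewrite (Nat.mul_comm j); module_eq.
rewrite sum_n_switch.
rewrite (sum_n_ext_loc _ (fun m => if Nat.eqb j m then x m else zero)) => [|m Hm].
  exact: sum_n_kronecker.
rewrite (sum_n_scal_r (fun i => Cmult (Cinv (RtoC (INR (S n)))) (Cmult (Cpow w (i * j)) (Cconj (Cpow w (i * m)))))).
rewrite -Csum_mult_l characters_orthogonal //.
case: Nat.eqb_spec => _.
  rewrite (_ : Cmult _ _ = RtoC 1); first exact: (scal_one (K := C_AbsRing)).
  exact: Cinv_l.
rewrite (_ : Cmult _ _ = RtoC 0); first exact: (scal_zero_l (K := C_AbsRing)).
exact: Cmult_0_r.
Qed.

Variables (form : V -> V -> C) (q : V -> R).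
Hypothesis form_plus : forall x y z, form (plus x y) z = Cplus (form x z) (form y z).
Hypothesis form_scal : forall (c : C) x y, form (scal c x) y = Cmult c (form x y).
Hypothesis form_conj : forall x y, form y x = Cconj (form x y).
Hypothesis form_diag : forall x, form x x = RtoC (q x).

Lemma form_sum_l f y m :
  form (sum_n f m) y = sum_n (G := C_AbelianMonoid) (fun k => form (f k) y) m.
Proof using form_plus.
elim: m => [|m IH]; first by rewrite !sum_O.
by rewrite !sum_Sn form_plus IH.
Qed.

Lemma form_sum_r f x m :
  form x (sum_n f m) = sum_n (G := C_AbelianMonoid) (fun k => form x (f k)) m.
Proof using form_plus form_conj.
elim: m => [|m IH]; first by rewrite !sum_O.
rewrite !sum_Sn form_conj form_plus Cplus_conj -!form_conj IH //.
Qed.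

(** Parseval's identity for the quadratic form of an arbitrary Hermitian form,
    possibly degenerate. *)
Lemma parseval Z :
  sum_n (fun j => q (fourier Z j)) n = INR (S n) * sum_n (fun l => q (Z l)) n.
Proof using form_plus form_scal form_conj form_diag.
apply: RtoC_inj; rewrite RtoC_mult !RtoC_sum_n.
rewrite (sum_n_ext _ (fun j => sum_n (G := C_AbelianMonoid) (fun l => sum_n (G := C_AbelianMonoid) (fun m =>
  Cmult (form (Z l) (Z m)) (Cmult (Cpow w (j * l)) (Cconj (Cpow w (j * m))))) n) n)); last first.
  move=> j; rewrite -form_diag /fourier form_sum_l; apply: sum_n_ext => l.
  rewrite form_sum_r; apply: sum_n_ext => m.
  rewrite form_scal (form_conj (scal _ (Z m))) form_scal Cmult_conj -form_conj; C_ring.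
rewrite sum_n_switch Csum_mult_l; apply: sum_n_ext_loc => l Hl.
rewrite sum_n_switch.
rewrite (sum_n_ext_loc _ (fun m => if Nat.eqb l m then Cmult (RtoC (INR (S n))) (RtoC (q (Z m))) else zero)).
  by rewrite sum_n_kronecker.
move=> m Hm; rewrite -Csum_mult_l characters_orthogonal //.
case: Nat.eqb_spec => [->|_]; last exact: Cmult_0_r.
rewrite form_diag; exact: Cmult_comm.
Qed.
End Transform.
End RootsOfUnity.

(** * Von Neumann's inequality *)

Lemma poly_eval_bound_ge_0 a d s z : Cmod (poly_eval a d z) <= s -> 0 <= s.
Proof. by have := Cmod_ge_0 (poly_eval a d z); lra. Qed.

Lemma sum_n_le_add (f : nat -> R) m d :
  (forall k, 0 <= f k) -> sum_n f m <= sum_n f (m + d).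
Proof.
move=> Hf; elim: d => [|d IH]; first by rewrite Nat.add_0_r; lra.
rewrite Nat.add_succ_r sum_Sn /plus /=; have := Hf (S (m + d)); lra.
Qed.

Lemma sq_le_lim x s t :
  0 <= x -> 0 <= s -> 0 <= t < 1 ->
  (forall n, x ^ 2 <= s ^ 2 + (t ^ n * x) ^ 2) -> x <= s.
Proof.
move=> Hx Hs Ht H.
have L : is_lim_seq (fun n => s ^ 2 + (t ^ n * x) ^ 2) (s ^ 2).
  have G : is_lim_seq (fun n => t ^ n) 0.
    by apply: is_lim_seq_geom; rewrite Rabs_pos_eq; lra.
  have G' : is_lim_seq (fun n => t ^ n * x) (0 * x).
    exact: (is_lim_seq_mult' _ _ _ _ G (is_lim_seq_const x)).
  apply: (is_lim_seq_ext (fun n => s ^ 2 + (t ^ n * x) * (t ^ n * x))) => [n|]; first by ring.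
  rewrite (_ : Finite (s ^ 2) = Finite (s ^ 2 + (0 * x) * (0 * x))); last by congr Finite; ring.
  exact: (is_lim_seq_plus' _ _ _ _ (is_lim_seq_const _) (is_lim_seq_mult' _ _ _ _ G' G')).
have H2 : Rbar_le (x ^ 2) (s ^ 2).
  by refine (is_lim_seq_le _ _ _ _ H (is_lim_seq_const _) L).
by have {}H2 : x ^ 2 <= s ^ 2 := H2; nra.
Qed.

Section VonNeumann.
Context {H : HilbertSpace} (T : H -> H) (t : R) (HT : op_bound T t) (Ht : t < 1).

(* The defect form of a contraction is positive; it replaces the operator
   [1 - T^* T] and makes adjoints unnecessary. *)
Let defect_form (x y : H) : C := Cminus (inner x y) (inner (T x) (T y)).
Let defect (x : H) : R := norm x ^ 2 - norm (T x) ^ 2.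

Lemma defect_ge_0 x : 0 <= defect x.
Proof using HT Ht.
case: HT => _ [t0 /(_ x) Hx]; rewrite /defect.
have x0 := norm_ge_0 x; have Tx0 := norm_ge_0 (T x).
have : norm (T x) <= norm x by nra.
nra.
Qed.

Lemma defect_scal (c : C) x : defect (scal c x) = Cmod c ^ 2 * defect x.
Proof using HT.
case: HT => HL _.
by rewrite /defect (linear_scal T HL) !norm_scal_C; ring.
Qed.

Lemma defect_telescope x n :
  sum_n (fun j => defect (Nat.iter j T x)) n = norm x ^ 2 - norm (Nat.iter (S n) T x) ^ 2.
Proof.
elim: n => [|n IH]; first by rewrite sum_O.
by rewrite sum_Sn IH /plus /defect /=; ring.
Qed.

Lemma poly_apply_iter a d j h :
  Nat.iter j T (poly_apply a d T h) = sum_n (fun k => scal (a k) (Nat.iter (k + j) T h)) d.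
Proof using HT.
case: (op_bound_iter T t j HT) => HL _.
rewrite /poly_apply (linear_sum_n _ HL); apply: sum_n_ext => k.
by rewrite (linear_scal _ HL) -Nat.iter_add Nat.add_comm.
Qed.

(** The squared norm of a vector is the sum of the defects along its orbit,
    since the powers of [T] tend to 0. Up to index [m] the orbit of [p(T) h] is
    obtained from that of [h] by a Fourier multiplier with values [p(w^l)], and
    Parseval's identity for the defect form bounds it by [sup |p|]. *)
Lemma von_neumann_poly a d s h :
  (forall z, Cmod z = 1 -> Cmod (poly_eval a d z) <= s) ->
  norm (poly_apply a d T h) <= s * norm h.
Proof using HT Ht.
move=> Hs; case: (HT) => HL [t0 Hb].
have s0 : 0 <= s by apply: poly_eval_bound_ge_0 (Hs (RtoC 1) Cmod_1).
set y := poly_apply a d T h.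
apply: (sq_le_lim _ _ t); try lra; first exact: norm_ge_0.
  by apply: Rmult_le_pos => //; apply: norm_ge_0.
move=> M.
have Horbit : sum_n (fun j => defect (Nat.iter j T y)) M <= s ^ 2 * norm h ^ 2; last first.
  move: Horbit; rewrite defect_telescope Rpow_mult_distr.
  case: (op_bound_iter T t (S M) HT) => _ [_ /(_ y)] /=.
  have := pow_le t M t0; have := norm_ge_0 y.
  set u := norm y; set v := norm (T _); set q := t ^ M => u0 q0 Hv.
  have v0 : 0 <= v by apply: norm_ge_0.
  have qu : 0 <= q * u by apply: Rmult_le_pos.
  have : v <= q * u by nra.
  by nra.
(* Indices up to [M] shifted by the degree [d] stay below the order of the group. *)
pose n := (M + d)%nat.
pose X := fourier_inv n (fun j => Nat.iter j T h).
pose p l := poly_eval a d (Cpow (root_of_unity n) l).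
have HX j : (j <= n)%nat -> fourier n X j = Nat.iter j T h.
  by move=> Hj; rewrite fourierK.
have HY j : (j <= M)%nat -> fourier n (fun l => scal (p l) (X l)) j = Nat.iter j T y.
  move=> Hj; rewrite poly_apply_iter.
  rewrite (sum_n_ext_loc _ (fun k => sum_n (fun l =>
    scal (a k) (scal (Cpow (root_of_unity n) ((k + j) * l)) (X l))) n)); last first.
    by move=> k Hk; rewrite (sum_n_scal_l (K := C_Ring)) -HX //; lia.
  rewrite sum_n_switch; apply: sum_n_ext => l.
  rewrite (sum_n_ext _ (fun k => scal (Cmult (Cpow (root_of_unity n) (j * l))
    (Cmult (a k) (Cpow (Cpow (root_of_unity n) l) k))) (X l))); last first.
    move=> k; rewrite Nat.mul_add_distr_r Cpow_add_r (Nat.mul_comm k) (Cpow_mult_r _ l k).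
    by module_eq.
  rewrite (sum_n_scal_r (fun k => Cmult (Cpow (root_of_unity n) (j * l))
    (Cmult (a k) (Cpow (Cpow (root_of_unity n) l) k)))) -Csum_mult_l.
  by rewrite /p /poly_eval; module_eq.
have P Z : sum_n (fun j => defect (fourier n Z j)) n = INR (S n) * sum_n (fun l => defect (Z l)) n.
  apply: (parseval n defect_form) => [x1 x2 z|c x1 x2|x1 x2|x1]; rewrite /defect_form.
  - by rewrite (linear_plus T HL) !inner_plus_l; ring.
  - by rewrite (linear_scal T HL) !inner_scal_l; ring.
  - by rewrite (inner_conj _ x1 x2) (inner_conj _ (T x1) (T x2)) Cminus_conj.
  - by rewrite !inner_norm -RtoC_minus.
apply: Rle_trans (_ : sum_n (fun j => defect (fourier n (fun l => scal (p l) (X l)) j)) n <= _).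
  rewrite (sum_n_ext_loc _ (fun j => defect (fourier n (fun l => scal (p l) (X l)) j))).
    by apply: sum_n_le_add => k; apply: defect_ge_0.
  by move=> j Hj; rewrite HY.
rewrite P.
have Hn : 0 < INR (S n) by apply: lt_0_INR; lia.
apply: Rle_trans (_ : s ^ 2 * (INR (S n) * sum_n (fun l => defect (X l)) n) <= _).
  rewrite (_ : forall u v w, u * (v * w) = v * (u * w)); last by move=> *; ring.
  apply: Rmult_le_compat_l; first lra.
  rewrite (_ : s ^ 2 * _ = sum_n (fun l => s ^ 2 * defect (X l)) n); last first.
    by symmetry; apply: (sum_n_mult_l (K := R_Ring)).
  apply: sum_n_m_le => l; rewrite defect_scal.
  have Hp : Cmod (p l) <= s by apply: Hs; apply: Cmod_root_of_unity.
  have := Cmod_ge_0 (p l); have := defect_ge_0 (X l) => H1 H2.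
  by apply: Rmult_le_compat_r => //; nra.
rewrite -P; apply: Rmult_le_compat_l; first by apply: pow2_ge_0.
rewrite (sum_n_ext_loc _ (fun j => defect (Nat.iter j T h))); last first.
  by move=> j Hj; rewrite HX.
rewrite defect_telescope; have := pow2_ge_0 (norm (Nat.iter (S n) T h)); lra.
Qed.
End VonNeumann.

(** Multiplication by [z] on this one-dimensional space turns statements on
    operators into statements on functions. *)
Definition C_Hilbert : HilbertSpace.
Proof.
apply: (Build_HilbertSpace C_CompleteNormedModule (fun x y => Cmult x (Cconj y))).
- move=> x y z; exact: Cmult_plus_distr_r.
- move=> c x y; symmetry; exact: Cmult_assoc.
- by move=> x y; rewrite Cmult_conj Cconj_conj Cmult_comm.
- by move=> x; rewrite -Cmod2_conj.
Defined.

Definition mulC (z : C) : C_CompleteNormedModule -> C_CompleteNormedModule := Cmult z.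

Lemma op_bound_mulC z : op_bound (mulC z) (Cmod z).
Proof.
apply: op_bound_intro => [x y|c x||x].
- exact: Cmult_plus_distr_l.
- rewrite /mulC /scal /= /mult /=; C_ring.
- exact: Cmod_ge_0.
- by rewrite /mulC (_ : norm (Cmult z x) = Cmod z * norm x); [lra|exact: Cmod_mult].
Qed.

Definition eval_series (a : nat -> C) (z : C) : C := opseries a (mulC z) (RtoC 1).

Lemma iter_mulC z n : Nat.iter n (mulC z) (RtoC 1) = Cpow z n.
Proof. by elim: n => //= n ->. Qed.

Lemma pow_n_Cpow (z : C) n : pow_n (K := C_AbsRing) z n = Cpow z n.
Proof. by elim: n => //= n ->. Qed.

Lemma poly_apply_mulC a n z : poly_apply a n (mulC z) (RtoC 1 : C_NormedModule) = poly_eval a n z.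
Proof. by apply: sum_n_ext => k; rewrite iter_mulC. Qed.

(** The convergence is geometric because the coefficients are dominated by those
    of a geometric series of a radius strictly between [R] and 1. *)
Lemma poly_eval_tail a R : disc_series a -> 0 <= R < 1 ->
  exists K q, 0 <= q < 1 /\ forall d z, Cmod z <= R ->
    Cmod (Cminus (eval_series a z) (poly_eval a d z)) <= K * q ^ d.
Proof.
move=> Ha HR; case: (Ha ((R + 1) / 2)); first lra.
set R' := (R + 1) / 2 => M HM.
have HR' : R < R' < 1 by rewrite /R'; lra.
have HM0 : 0 <= M by have := HM 0%nat; have := Cmod_ge_0 (a 0%nat) => /=; lra.
have Hq : 0 <= R / R' < 1.
  split; first by apply: Rmult_le_pos; [lra|apply/Rlt_le/Rinv_0_lt_compat; lra].
  by apply/Rlt_div_l; lra.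
exists (M * (R / R') * / (1 - R / R')), (R / R'); split=> // d z Hz.
have Hz1 : Cmod z < 1 by lra.
have Hs := opseries_correct (mulC z) _ (op_bound_mulC z) Hz1 a (RtoC 1) Ha.
have Ht : is_series (fun k => scal (a (S d + k)%nat) (Nat.iter (S d + k) (mulC z) (RtoC 1)))
    (minus (eval_series a z) (poly_eval a d z) : C_CompleteNormedModule).
  apply: (is_series_incr_n (fun k => scal (a k) (Nat.iter k (mulC z) (RtoC 1)))); first lia.
  rewrite -(poly_apply_mulC a d z) /=.
  rewrite (_ : plus _ _ = opseries a (mulC z) (RtoC 1)) //.
  by rewrite /minus -plus_assoc plus_opp_l plus_zero_r.
have Hg := geom_series (R / R') (M * (R / R') ^ S d) Hq.
apply: Rle_trans (series_norm_le _ _ _ _ Ht Hg _) _.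
  move=> n; rewrite norm_scal_C iter_mulC.
  rewrite (_ : norm (Cpow z (S d + n)) = Cmod z ^ (S d + n)); last exact: Cmod_pow.
  rewrite Rmult_assoc -pow_add.
  set m := (S d + n)%nat.
  rewrite /Rdiv Rpow_mult_distr pow_inv.
  have Hp : 0 < R' ^ m by apply: pow_lt; lra.
  have Ha' : Cmod (a m) <= M * / R' ^ m by apply/Rle_div_r => //; apply: HM.
  have Hzm : Cmod z ^ m <= R ^ m by apply: pow_incr; split=> //; apply: Cmod_ge_0.
  have := Rmult_le_compat _ _ _ _ (Cmod_ge_0 _) (pow_le _ m (Cmod_ge_0 z)) Ha' Hzm.
  lra.
by rewrite /=; lra.
Qed.

Lemma iter_scal {V : NormedModule C_AbsRing} (T : V -> V) c k h :
  is_linear T ->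
  Nat.iter k (fun x => scal c (T x)) h = scal (Cpow c k) (Nat.iter k T h).
Proof.
move=> HT; elim: k => [|k IH] /=; first by module_eq.
by rewrite IH (linear_scal T HT); module_eq.
Qed.

Lemma poly_apply_scale {V : NormedModule C_AbsRing} a d (T : V -> V) c h :
  is_linear T ->
  poly_apply a d (fun x => scal c (T x)) h = poly_apply (fun k => Cmult (a k) (Cpow c k)) d T h.
Proof. by move=> HT; apply: sum_n_ext => k; rewrite iter_scal //; module_eq. Qed.

Section VonNeumannSeries.
Context {H : HilbertSpace} (T : H -> H) (t R : R) (HT : op_bound T t).
Context (HR : t < R).

(** The polynomial [p(R z)] at the strict contraction [T / R]. *)
Lemma von_neumann_radius a d s h :
  (forall z, Cmod z = R -> Cmod (poly_eval a d z) <= s) ->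
  norm (poly_apply a d T h) <= s * norm h.
Proof using HT HR.
move=> Hs; case: (HT) => HL [t0 _].
have R0 : 0 < R by lra.
have RC0 : RtoC R <> RtoC 0 by move/RtoC_inj; lra.
pose S x := scal (Cinv (RtoC R)) (T x).
have HS : op_bound S (Cmod (Cinv (RtoC R)) * t) by apply: op_bound_scal.
have Ht : Cmod (Cinv (RtoC R)) * t < 1.
  rewrite Cmod_inv // Cmod_R Rabs_pos_eq; last lra.
  by rewrite Rmult_comm; apply/Rlt_div_l; lra.
have -> : poly_apply a d T h = poly_apply (fun k => Cmult (a k) (Cpow (RtoC R) k)) d S h.
  rewrite poly_apply_scale //; apply: sum_n_ext => k; congr (scal _ _).
  rewrite Cpow_inv //.
  match goal with |- @eq _ ?u ?v => change (@eq C u v) end.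
  by field; apply: Cpow_nz.
apply: (von_neumann_poly S _ HS Ht) => z Hz.
have -> : poly_eval (fun k => Cmult (a k) (Cpow (RtoC R) k)) d z = poly_eval a d (Cmult (RtoC R) z).
  by apply: sum_n_ext => k; rewrite Cpow_mult_l; C_ring.
by apply: Hs; rewrite Cmod_mult Hz Cmod_R Rabs_pos_eq; lra.
Qed.

(** On the circle of radius [R] the partial sums are within [K q^d] of the sum,
    so the polynomial inequality passes to the limit. *)
Lemma von_neumann_series a s h : R < 1 -> disc_series a ->
  (forall z, Cmod z = R -> Cmod (eval_series a z) <= s) ->
  norm (opseries a T h) <= s * norm h.
Proof using HT HR.
move=> R1 Ha Hs; case: (HT) => _ [t0 _].
case: (poly_eval_tail a R Ha) => [|K [q [Hq HK]]]; first lra.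
have Hd d : norm (poly_apply a d T h) <= (s + K * q ^ d) * norm h.
  apply: von_neumann_radius => z Hz.
  have := Cmod_dist_ge (poly_eval a d z) (eval_series a z).
  have := HK d z ltac:(lra); have := Hs z Hz.
  rewrite -(Cmod_opp (Cminus _ _)).
  rewrite (_ : Copp _ = Cminus (poly_eval a d z) (eval_series a z)); last by ring.
  lra.
have L1 := limit_norm _ _ (opseries_correct T t HT ltac:(lra) a h Ha).
have G : is_lim_seq (fun n => q ^ n) 0.
  by apply: is_lim_seq_geom; rewrite Rabs_pos_eq; lra.
have L2 := is_lim_seq_mult' _ _ _ _ (is_lim_seq_plus' _ _ _ _ (is_lim_seq_const s)
  (is_lim_seq_mult' _ _ _ _ (is_lim_seq_const K) G)) (is_lim_seq_const (norm h)).
have Hl : Rbar_le (norm (opseries a T h)) ((s + K * 0) * norm h).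
  exact: (is_lim_seq_le _ _ _ _ Hd L1 L2).
by move: Hl => /=; lra.
Qed.
End VonNeumannSeries.

(** The maximum principle is von Neumann's inequality for a multiplication
    operator on the Hilbert space [C]. *)
Lemma maximum_principle a R s z : R < 1 -> disc_series a ->
  (forall w, Cmod w = R -> Cmod (eval_series a w) <= s) ->
  Cmod z < R -> Cmod (eval_series a z) <= s.
Proof.
move=> HR Ha Hs Hz.
have := von_neumann_series (H := C_Hilbert) (mulC z) _ _ (op_bound_mulC z) Hz a s (RtoC 1) HR Ha Hs.
rewrite (_ : norm _ = Cmod (eval_series a z)) //.
rewrite (_ : norm (RtoC 1 : C_Hilbert) = 1); last exact: Cmod_1.
lra.
Qed.

Lemma limit_sum_n {V : NormedModule C_AbsRing} (f : nat -> nat -> V) l d :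
  (forall k, filterlim (fun n => f n k) eventually (locally (l k))) ->
  filterlim (fun n => sum_n (f n) d) eventually (locally (sum_n l d)).
Proof.
move=> Hf; elim: d => [|d IH].
  rewrite sum_O; apply: (filterlim_ext (fun n => f n 0%nat)) => // n.
  by rewrite sum_O.
rewrite sum_Sn.
apply: (filterlim_ext (fun n => plus (sum_n (f n) d) (f n (S d)))) => [n|].
  by rewrite sum_Sn.
refine (filterlim_comp_2 _ _ (fun x y => plus x y) IH (Hf (S d)) _).
exact: filterlim_plus.
Qed.

Definition radius (n : nat) : R := 1 - / INR (S (S n)).

Lemma radius_bounds n : 0 < radius n < 1.
Proof.
rewrite /radius.
have Hn : 1 < INR (S (S n)) by apply: lt_1_INR; lia.
have := Rinv_0_lt_compat _ (Rlt_trans _ _ _ Rlt_0_1 Hn).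
have : / INR (S (S n)) < 1 by rewrite -Rinv_1; apply: Rinv_lt_contravar; lra.
lra.
Qed.

Lemma radius_lim : is_lim_seq radius 1.
Proof.
rewrite (_ : Finite 1 = Finite (1 - 0)); last by congr Finite; ring.
apply: is_lim_seq_minus'; first exact: is_lim_seq_const.
have := is_lim_seq_INR; rewrite (is_lim_seq_incr_1 INR) => /(is_lim_seq_incr_1 (fun n => INR (S n))) L.
exact: (is_lim_seq_inv _ _ L).
Qed.

(** Only [r T] with [r < 1] is a strict contraction; for a polynomial the
    inequality survives the limit [r -> 1]. *)
Lemma von_neumann_contraction {H : HilbertSpace} (T : H -> H) a d s h :
  op_bound T 1 -> (forall z, Cmod z < 1 -> Cmod (poly_eval a d z) <= s) ->
  norm (poly_apply a d T h) <= s * norm h.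
Proof.
move=> HT Hs; case: (HT) => HL _.
have Hn n : norm (poly_apply a d (fun x => scal (RtoC (radius n)) (T x)) h) <= s * norm h.
  have Hr := radius_bounds n.
  apply: (von_neumann_radius _ (Cmod (RtoC (radius n)) * 1) ((radius n + 1) / 2)).
  - exact: op_bound_scal.
  - by rewrite Cmod_R Rabs_pos_eq; lra.
  - by move=> z Hz; apply: Hs; rewrite Hz; lra.
have L : filterlim (fun n => poly_apply a d (fun x => scal (RtoC (radius n)) (T x)) h)
    eventually (locally (poly_apply a d T h)).
  apply: (filterlim_ext (fun n => sum_n (fun k => scal (Cmult (a k) (Cpow (RtoC (radius n)) k)) (Nat.iter k T h)) d)) => [n|].
    by rewrite poly_apply_scale.
  apply: limit_sum_n => k; apply/limit_dist.
  apply: (is_lim_seq_ext (fun n => Cmod (a k) * Rabs (radius n ^ k - 1) * norm (Nat.iter k T h))) => [n|].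
    rewrite -Cmod_R -Cmod_mult -norm_scal_C; congr norm.
    by rewrite RtoC_minus RtoC_pow; module_eq.
  have Lk : is_lim_seq (fun n => radius n ^ k) 1.
    elim: k => [|k IH] /=; first exact: is_lim_seq_const.
    rewrite (_ : Finite 1 = Finite (1 * 1)); last by congr Finite; ring.
    exact: (is_lim_seq_mult' _ _ _ _ radius_lim IH).
  have La := is_lim_seq_abs _ _ (is_lim_seq_minus' _ _ _ _ Lk (is_lim_seq_const 1)).
  have := is_lim_seq_mult' _ _ _ _ (is_lim_seq_mult' _ _ _ _ (is_lim_seq_const (Cmod (a k))) La) (is_lim_seq_const (norm (Nat.iter k T h))).
  by rewrite (_ : 1 - 1 = 0) ?Rabs_R0 ?Rmult_0_r ?Rmult_0_l //; ring.
have Hl : Rbar_le (norm (poly_apply a d T h)) (s * norm h).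
  exact: (is_lim_seq_le _ _ _ _ Hn (limit_norm _ _ L) (is_lim_seq_const _)).
exact: Hl.
Qed.

(** * Dividing by Blaschke factors *)

Lemma eval_affine p q a z : Cmod z < 1 -> disc_series a ->
  eval_series (coef_affine p q a) z = Cmult (Cplus p (Cmult q z)) (eval_series a z).
Proof.
move=> Hz Ha; rewrite /eval_series (opseries_affine (mulC z) _ p q a _ (op_bound_mulC z) Hz Ha).
rewrite /affine /mulC.
change (Cplus (Cmult p (eval_series a z)) (Cmult q (Cmult z (eval_series a z))) =
  Cmult (Cplus p (Cmult q z)) (eval_series a z)).
ring.
Qed.

Lemma eval_coef_iter p q k a z : Cmod z < 1 -> disc_series a ->
  eval_series (coef_iter p q k a) z = Cmult (Cpow (Cplus p (Cmult q z)) k) (eval_series a z).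
Proof.
move=> Hz Ha; elim: k => [|k IH]; first by rewrite /= Cmult_1_l.
rewrite /coef_iter /= -/(coef_iter p q k a) eval_affine //; last exact: disc_series_iter.
by rewrite IH; ring.
Qed.

Lemma eval_correct a z : Cmod z < 1 -> disc_series a ->
  is_series (fun n => Cmult (a n) (Cpow z n) : C_NormedModule) (eval_series a z).
Proof.
move=> Hz Ha.
apply: is_series_ext (opseries_correct (mulC z) _ (op_bound_mulC z) Hz a (RtoC 1) Ha) => n.
by rewrite iter_mulC.
Qed.

Lemma eval_unique a z l :
  is_series (fun n => Cmult (a n) (Cpow z n) : C_NormedModule) l -> eval_series a z = l.
Proof.
move=> Hl; apply: opseries_unique; apply: is_series_ext Hl => n.
by rewrite iter_mulC.
Qed.

Lemma disc_series_shift a m : disc_series a -> disc_series (fun n => a (m + n)%nat).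
Proof.
move=> Ha R HR; case: (Ha R HR) => M HM.
have Hm : 0 < R ^ m by apply: pow_lt; lra.
exists (M / R ^ m) => n; apply: (proj1 (Rle_div_r _ _ _ Hm)).
rewrite Rmult_assoc (Rmult_comm (R ^ n)) -pow_add; exact: HM.
Qed.

Lemma eval_split a z : Cmod z < 1 -> disc_series a ->
  eval_series a z = Cplus (a 0%nat) (Cmult z (eval_series (fun n => a (S n)) z)).
Proof.
move=> Hz Ha; apply: eval_unique; apply: is_series_decr_1.
have Hs := eval_correct (fun n => a (S n)) z Hz (disc_series_shift a 1 Ha).
rewrite (_ : plus _ _ = scal z (eval_series (fun n => a (S n)) z : C_NormedModule)); last first.
  change (Cplus (Cplus (a 0%nat) (Cmult z (eval_series (fun n => a (S n)) z))) (Copp (Cmult (a 0%nat) (RtoC 1)))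
    = Cmult z (eval_series (fun n => a (S n)) z)); ring.
apply: is_series_ext (is_series_scal z _ _ Hs) => n.
change (Cmult z (Cmult (a (S n)) (Cpow z n)) = Cmult (a (S n)) (Cpow z (S n))).
by rewrite Cpow_S; ring.
Qed.

(** Coefficients of [(f(z) - f(c)) / (z - c)]. *)
Definition quotient (c : C) (a : nat -> C) (j : nat) : C :=
  eval_series (fun n => a (S (j + n))) c.

Definition sub_const (a : nat -> C) (c : C) (n : nat) : C :=
  match n with O => Cminus (a O) c | _ => a n end.

Lemma poly_apply_sub_const {V : NormedModule C_AbsRing} (T : V -> V) a w d h :
  poly_apply (sub_const a w) d T h = minus (poly_apply a d T h) (scal w h).
Proof.
elim: d => [|d IH]; first by rewrite /poly_apply !sum_O /=; module_eq.
by move: IH; rewrite /poly_apply !sum_Sn => -> /=; module_eq.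
Qed.

Lemma opseries_sub_const {V : CompleteNormedModule C_AbsRing} (T : V -> V) t a w h :
  op_bound T t -> t < 1 -> disc_series a ->
  opseries (sub_const a w) T h = minus (opseries a T h) (scal w h).
Proof.
move=> HT Ht Ha; apply: opseries_unique.
apply: (filterlim_ext (fun d => minus (poly_apply a d T h) (scal w h))) => [d|].
  by rewrite -poly_apply_sub_const.
refine (filterlim_comp_2 _ _ (fun x y => plus x y)
  (opseries_correct T t HT Ht a h Ha) (filterlim_const (opp (scal w h))) _).
exact: filterlim_plus.
Qed.

Lemma eval_sub_const a z w : Cmod z < 1 -> disc_series a ->
  eval_series (sub_const a w) z = Cminus (eval_series a z) w.
Proof.
move=> Hz Ha; rewrite /eval_series (opseries_sub_const _ _ a w _ (op_bound_mulC z) Hz Ha).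
rewrite -[in RHS](Cmult_1_r w) //.
Qed.

Section Division.
Variable c : C.
Hypothesis Hc : Cmod c < 1.

Lemma quotient_step a j : disc_series a ->
  quotient c a j = Cplus (a (S j)) (Cmult c (quotient c a (S j))).
Proof using Hc.
move=> Ha; rewrite /quotient eval_split //; last exact: (disc_series_shift a (S j)).
rewrite Nat.add_0_r; congr (Cplus _ (Cmult _ (eval_series _ _))).
by apply: functional_extensionality => n; rewrite Nat.add_succ_r.
Qed.

Lemma quotient_spec a : disc_series a ->
  coef_affine (Copp c) (RtoC 1) (quotient c a) = sub_const a (eval_series a c).
Proof using Hc.
move=> Ha; apply: functional_extensionality => -[|n] /=.
  by rewrite (eval_split a) // /quotient /=; ring.
by rewrite (quotient_step a n) //; ring.
Qed.

Lemma quotient_finite a d : disc_series a ->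
  (forall k, (d < k)%nat -> a k = RtoC 0) ->
  forall k, (d <= k)%nat -> quotient c a k = RtoC 0.
Proof.
move=> Ha H0 k Hk; apply: eval_unique.
apply: (is_series_ext (fun _ => zero)) => [n|].
  by rewrite H0; [symmetry; exact: Cmult_0_l|lia].
rewrite /is_series; apply: (filterlim_ext (fun _ => zero)); last exact: filterlim_const.
by move=> n; elim: n => [|n IH]; rewrite ?sum_O // sum_Sn -IH plus_zero_l.
Qed.

Lemma disc_series_quotient a : disc_series a -> disc_series (quotient c a).
Proof using Hc.
move=> Ha; apply: (disc_series_near _ (Cmod c)) => // R HR R0.
case: (Ha R) => [|M HM]; first lra.
have Hc0 := Cmod_ge_0 c.
have Hq : 0 <= Cmod c / R < 1.
  split; first by apply: Rmult_le_pos => //; apply/Rlt_le/Rinv_0_lt_compat.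
  by apply/Rlt_div_l; lra.
exists (M / R * / (1 - Cmod c / R)) => j.
have Rj : 0 < R ^ j by apply: pow_lt.
have Hs := eval_correct _ c Hc (disc_series_shift a (S j) Ha).
have Hg := geom_series (Cmod c / R) (M / R / R ^ j) Hq.
have Hl : Cmod (quotient c a j) <= M / R / R ^ j * / (1 - Cmod c / R).
  apply: series_norm_le Hs Hg _ => n.
  rewrite (_ : norm _ = Cmod (a (S j + n)%nat) * Cmod c ^ n); last first.
    by rewrite -Cmod_pow; exact: Cmod_mult.
  have Hp : 0 < R ^ (S j + n) by apply: pow_lt.
  have Ha' : Cmod (a (S j + n)%nat) <= M / R ^ (S j + n) by apply/Rle_div_r => //; apply: HM.
  have := Rmult_le_compat_r _ _ _ (pow_le _ n Hc0) Ha'.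
  rewrite /Rdiv Rpow_mult_distr pow_inv pow_add /= !Rinv_mult; lra.
apply: Rle_trans (Rmult_le_compat_r _ _ _ (Rlt_le _ _ Rj) Hl) _.
by right; field; split; [lra|split; lra].
Qed.
End Division.

Definition disc_bounded (a : nat -> C) (s : R) : Prop :=
  disc_series a /\ forall z, Cmod z < 1 -> Cmod (eval_series a z) <= s.

Lemma le_of_near_1 x s K R0 : 0 <= s -> 0 <= K -> R0 < 1 ->
  (forall R, R0 < R < 1 -> x <= s * (1 + K * (1 - R))) -> x <= s.
Proof.
move=> Hs HK HR0 H; apply: le_epsilon => eps Heps.
have HsK : 0 <= s * K by apply: Rmult_le_pos.
pose d := Rmin ((1 - R0) / 2) (eps / (s * K + 1)).
have He : 0 < eps / (s * K + 1) by apply: Rdiv_lt_0_compat; lra.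
have d0 : 0 < d by apply: Rmin_glb_lt; lra.
have d1 : d <= (1 - R0) / 2 := Rmin_l _ _.
have d2 : d * (s * K + 1) <= eps by apply/Rle_div_r; [lra|exact: Rmin_r].
have := H (1 - d) ltac:(lra).
by rewrite (_ : 1 - (1 - d) = d); [nra|ring].
Qed.

(** Numerator and denominator of the Blaschke factor have the same modulus on the
    unit circle. *)
Lemma Cmod2_blaschke (c z : C) :
  Cmod (Cminus (RtoC 1) (Cmult (Cconj c) z)) ^ 2
  = Cmod (Cminus z c) ^ 2 + (1 - Cmod c ^ 2) * (1 - Cmod z ^ 2).
Proof. by rewrite !Cmod2_alt; case: c => a b; case: z => x y /=; ring. Qed.

(** Schwarz's lemma: dividing by the Blaschke factor [(z - c) / (1 - c^* z)],
    whose modulus tends to 1 at the boundary, does not increase the supremum. *)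
Lemma schwarz c a s : Cmod c < 1 -> disc_bounded a s -> eval_series a c = RtoC 0 ->
  disc_bounded (coef_affine (RtoC 1) (Copp (Cconj c)) (quotient c a)) s.
Proof.
move=> Hc [Ha Hs] E.
have Hb := disc_series_quotient c Hc a Ha.
have Hd := disc_series_affine (RtoC 1) (Copp (Cconj c)) _ Hb.
split=> // z Hz.
have s0 : 0 <= s by have := Hs z Hz; have := Cmod_ge_0 (eval_series a z); lra.
have Hc0 := Cmod_ge_0 c.
pose d := (1 - Cmod c) / 2.
have d0 : 0 < d by rewrite /d; lra.
have H1 := Rmax_l (Cmod z) ((1 + Cmod c) / 2); have H2 := Rmax_r (Cmod z) ((1 + Cmod c) / 2).
apply: (le_of_near_1 _ s (2 / d ^ 2) (Rmax (Cmod z) ((1 + Cmod c) / 2))) => //.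
- by apply/Rlt_le/Rdiv_lt_0_compat; [lra|apply: pow_lt].
- by apply: Rmax_lub_lt; lra.
(* On the circle of radius [R] the inverse of the Blaschke factor has modulus
   at most [1 + 2 (1 - R) / d^2]. *)
move=> R HR; apply: (maximum_principle _ R) => //; try lra.
move=> w Hw; have Hw1 : Cmod w < 1 by lra.
rewrite eval_affine //.
have Ew : eval_series a w = Cmult (Cminus w c) (eval_series (quotient c a) w).
  rewrite (_ : Cminus w c = Cplus (Copp c) (Cmult (RtoC 1) w)); last by ring.
  rewrite -eval_affine // quotient_spec // eval_sub_const // E; ring.
have := Hs w Hw1; rewrite Ew !Cmod_mult.
rewrite (_ : Cplus _ _ = Cminus (RtoC 1) (Cmult (Cconj c) w)); last by ring.
have := Cmod2_blaschke c w; rewrite Hw.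
have := Cmod_dist_ge w c; rewrite Hw.
have := Cmod_ge_0 (Cminus (RtoC 1) (Cmult (Cconj c) w)).
have := Cmod_ge_0 (eval_series (quotient c a) w).
move: (Cmod (Cminus w c)) (Cmod (Cminus (RtoC 1) _)) (Cmod (eval_series _ _)).
move=> D N g g0 N0 HD HN Hg.
have Dd : d <= D by rewrite /d; lra.
have ND : N <= D * (1 + 2 / d ^ 2 * (1 - R)).
  have R0 : 0 < R by lra.
  have K1 : (1 - Cmod c ^ 2) * (1 - R ^ 2) <= 2 * (1 - R).
    have : (1 - Cmod c ^ 2) * (1 - R ^ 2) <= 1 * (1 - R ^ 2) by apply: Rmult_le_compat_r; nra.
    by nra.
  have K2 : N ^ 2 <= D ^ 2 + 2 * (1 - R) by lra.
  have K3 : 2 * (1 - R) <= D ^ 2 * (2 / d ^ 2 * (1 - R)).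
    have -> : D ^ 2 * (2 / d ^ 2 * (1 - R)) = 2 * (1 - R) * (D ^ 2 / d ^ 2) by field; lra.
    have : 1 <= D ^ 2 / d ^ 2 by apply/Rle_div_r; [apply: pow_lt|nra].
    by nra.
  have K4 : 0 <= 2 / d ^ 2 * (1 - R).
    by apply: Rmult_le_pos; [apply/Rlt_le/Rdiv_lt_0_compat; [lra|apply: pow_lt]|lra].
  move: K3 K4; set e := 2 / d ^ 2 * (1 - R) => K3 K4.
  have : N ^ 2 <= (D * (1 + e)) ^ 2 by nra.
  have : 0 <= D * (1 + e) by nra.
  by nra.
apply: Rle_trans (Rmult_le_compat_r _ _ _ g0 ND) _.
rewrite (_ : D * _ * g = D * g * (1 + 2 / d ^ 2 * (1 - R))); last by ring.
apply: Rmult_le_compat_r => //.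
have : 0 < 2 / d ^ 2 by apply: Rdiv_lt_0_compat; [lra|apply: pow_lt].
by nra.
Qed.

(** Apply Schwarz's lemma to [f - f(c)], bounded by [2 s], and divide by
    [1 - c^* z], whose modulus is at least [1 - |c|]. *)
Lemma quotient_bounded c a s : Cmod c < 1 -> disc_bounded a s ->
  disc_bounded (quotient c a) (2 * s / (1 - Cmod c)).
Proof.
move=> Hc [Ha Hs].
have Hb := disc_series_quotient c Hc a Ha.
split=> // z Hz.
pose a' := sub_const a (eval_series a c).
have Ha' : disc_bounded a' (2 * s).
  split; first by rewrite /a' -quotient_spec //; apply: disc_series_affine.
  move=> w Hw; rewrite /a' eval_sub_const //.
  apply: Rle_trans (Cmod_triangle _ _) _; rewrite Cmod_opp.
  have := Hs w Hw; have := Hs c Hc; lra.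
have E : eval_series a' c = RtoC 0 by rewrite /a' eval_sub_const //; ring.
case: (schwarz c a' _ Hc Ha' E) => _ /(_ z Hz).
rewrite (_ : quotient c a' = quotient c a) // eval_affine // Cmod_mult.
set g := Cmod (eval_series _ _) => Hg.
apply/Rle_div_r; first lra.
apply: Rle_trans Hg; rewrite Rmult_comm; apply: Rmult_le_compat_r; first exact: Cmod_ge_0.
have := Cmod_dist_ge (RtoC 1) (Cmult (Cconj c) z).
rewrite Cmod_1 Cmod_mult Cmod_conj.
rewrite (_ : Cminus _ _ = Cplus (RtoC 1) (Cmult (Copp (Cconj c)) z)); last by ring.
have := Cmod_ge_0 c; have := Cmod_ge_0 z; nra.
Qed.

(** A nonzero bounded analytic function has a finite order at [c]: after [k]
    divisions by the Blaschke factor [b] the supremum has not increased, so a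
    zero of infinite order would give [|u| <= B |b|^k] for all [k]. *)
Lemma finite_order c u B z0 : Cmod c < 1 -> disc_bounded u B ->
  Cmod z0 < 1 -> eval_series u z0 <> RtoC 0 ->
  exists k v, disc_bounded v B /\ eval_series v c <> RtoC 0 /\
    coef_iter (RtoC 1) (Copp (Cconj c)) k u = coef_iter (Copp c) (RtoC 1) k v.
Proof.
move=> Hc Hu Hz Hne; apply: NNPP => Hno.
have Hall k : exists v, disc_bounded v B /\
    coef_iter (RtoC 1) (Copp (Cconj c)) k u = coef_iter (Copp c) (RtoC 1) k v.
  elim: k => [|k [v [Hv E]]]; first by exists u.
  case: (classic (eval_series v c = RtoC 0)) => [E0|E0]; last by case: Hno; exists k, v.
  exists (coef_affine (RtoC 1) (Copp (Cconj c)) (quotient c v)); split; first exact: schwarz.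
  have Ev : coef_affine (Copp c) (RtoC 1) (quotient c v) = v.
    rewrite quotient_spec ?E0; [|exact: Hc|by case: Hv].
    by apply: functional_extensionality => -[|n] //=; ring.
  rewrite /coef_iter Nat.iter_succ -/(coef_iter _ _ k u) E.
  rewrite Nat.iter_succ_r coef_affine_comm Ev.
  rewrite /coef_iter; elim: k {E} => //= k <-; exact: coef_affine_comm.
case: Hu => Hu HB.
set N := Cmod (Cplus (RtoC 1) (Cmult (Copp (Cconj c)) z0)).
set D := Cmod (Cplus (Copp c) (Cmult (RtoC 1) z0)).
have HDN : D < N.
  have := Cmod2_blaschke c z0.
  rewrite (_ : Cminus (RtoC 1) _ = Cplus (RtoC 1) (Cmult (Copp (Cconj c)) z0)); last by ring.
  rewrite (_ : Cminus z0 c = Cplus (Copp c) (Cmult (RtoC 1) z0)); last by ring.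
  rewrite -/N -/D.
  have := Cmod_ge_0 c; have := Cmod_ge_0 z0.
  have N0 : 0 <= N := Cmod_ge_0 _; have D0 : 0 <= D := Cmod_ge_0 _.
  move=> c0 zz E; have : 0 < (1 - Cmod c ^ 2) * (1 - Cmod z0 ^ 2) by apply: Rmult_lt_0_compat; nra.
  by nra.
have D0 : 0 <= D := Cmod_ge_0 _.
have Hk k : Cmod (eval_series u z0) <= B * (D / N) ^ k.
  case: (Hall k) => v [[Hv Hvb] E].
  have := f_equal (fun f => Cmod (eval_series f z0)) E.
  rewrite !eval_coef_iter // !Cmod_mult !Cmod_pow -/N -/D => Ek.
  have Np : 0 < N ^ k by apply: pow_lt; lra.
  rewrite /Rdiv Rpow_mult_distr pow_inv -Rmult_assoc; apply/Rle_div_r => //.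
  rewrite Rmult_comm Ek Rmult_comm; apply: Rmult_le_compat_r; first exact: pow_le.
  exact: Hvb.
have L : is_lim_seq (fun k => B * (D / N) ^ k) (B * 0).
  apply: is_lim_seq_mult'; first exact: is_lim_seq_const.
  apply: is_lim_seq_geom; rewrite Rabs_pos_eq.
    by apply/Rlt_div_l; lra.
  by apply: Rmult_le_pos => //; apply/Rlt_le/Rinv_0_lt_compat; lra.
have Hl : Rbar_le (Cmod (eval_series u z0)) (B * 0).
  exact: (is_lim_seq_le _ _ _ _ Hk (is_lim_seq_const _) L).
by apply: Hne; apply: Cmod_eq_0; move: Hl => /=; have := Cmod_ge_0 (eval_series u z0); lra.
Qed.

(** * Strong limits of commuting operators *)

Lemma uniform_limit {V : NormedModule C_AbsRing} (S : nat -> V -> V) c (x : nat -> V) y z :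
  (forall n, op_bound (S n) c) ->
  filterlim x eventually (locally y) ->
  filterlim (fun n => S n y) eventually (locally z) ->
  filterlim (fun n => S n (x n)) eventually (locally z).
Proof.
move=> HS /limit_dist Hx /limit_dist Hy; apply/limit_dist.
apply: (is_lim_seq_le_le (fun _ => 0) _ (fun n => c * norm (minus (x n) y) + norm (minus (S n y) z))).
- move=> n; split; first exact: norm_ge_0.
  case: (HS n) => HL [c0 /(_ (minus (x n) y))]; rewrite (linear_minus _ _ _ HL).
  have := norm_dist_triangle (S n (x n)) (S n y) z; lra.
- exact: is_lim_seq_const.
rewrite (_ : Finite 0 = Finite (c * 0 + 0)); last by congr Finite; ring.
apply: is_lim_seq_plus' Hy.
exact: (is_lim_seq_mult' _ _ _ _ (is_lim_seq_const c) Hx).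
Qed.

Lemma limit_norm_le {V : NormedModule C_AbsRing} (f : nat -> V) l (B : R) :
  filterlim f eventually (locally l) -> (forall n, norm (f n) <= B) -> norm l <= B.
Proof.
move=> Hf Hb.
exact: (is_lim_seq_le _ _ (norm l) B Hb (limit_norm _ _ Hf) (is_lim_seq_const B)).
Qed.

Lemma cauchy_by_domination {V : CompleteNormedModule C_AbsRing} {W : NormedModule C_AbsRing}
    (y : nat -> V) (z : nat -> W) l K :
  0 <= K -> filterlim z eventually (locally l) ->
  (forall m n, norm (minus (y m) (y n)) <= K * norm (minus (z m) (z n))) ->
  exists l', filterlim y eventually (locally l').
Proof.
move=> HK /limit_dist Hz Hd; apply/filterlim_locally_cauchy => eps.
have He : 0 < eps / (2 * (K + 1)) by apply: Rdiv_lt_0_compat; [exact: cond_pos|lra].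
exists (fun n => norm (minus (z n) l) < eps / (2 * (K + 1))); split.
  have := proj2 (is_lim_seq_spec _ _) Hz (mkposreal _ He); apply: filter_imp => n /=.
  by rewrite Rminus_0_r Rabs_pos_eq //; exact: norm_ge_0.
move=> m n Hm Hn; apply: (norm_compat1 (K := C_AbsRing)).
rewrite (_ : norm _ = norm (minus (y n) (y m))) //.
apply: Rle_lt_trans (Hd n m) _.
have := norm_dist_triangle (z n) l (z m); rewrite (norm_minus_sym l) => Ht.
have {Hm Hn} Hmn : norm (minus (z n) (z m)) <= 2 * (eps / (2 * (K + 1))) by lra.
apply: Rle_lt_trans (Rmult_le_compat_l _ _ _ HK Hmn) _.
rewrite (_ : K * _ = eps * (K / (K + 1))); last by field; lra.
rewrite -{2}(Rmult_1_r eps); apply: Rmult_lt_compat_l; first exact: cond_pos.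
by apply/Rlt_div_l; lra.
Qed.

Section StrongLimit.
Context {V : CompleteNormedModule C_AbsRing} (S : nat -> V -> V) (c : R).
Hypothesis HS : forall n, op_bound (S n) c.
Hypothesis Hconv : forall h, exists l, filterlim (fun n => S n h) eventually (locally l).

Definition strong_limit (h : V) : V :=
  iota (fun l => filterlim (fun n => S n h) eventually (locally l)).

Lemma strong_limit_correct h :
  filterlim (fun n => S n h) eventually (locally (strong_limit h)).
Proof using Hconv.
case: (Hconv h) => l Hl.
by rewrite /strong_limit (iota_filterlim_locally _ _ Hl).
Qed.

Lemma strong_limit_unique h l :
  filterlim (fun n => S n h) eventually (locally l) -> strong_limit h = l.
Proof.
by move=> Hl; rewrite /strong_limit (iota_filterlim_locally _ _ Hl).
Qed.

Lemma strong_limit_bound : op_bound strong_limit c.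
Proof using HS Hconv.
apply: op_bound_intro => [x y|d x||x].
- apply: strong_limit_unique.
  apply: (filterlim_ext (fun n => plus (S n x) (S n y))) => [n|].
    by case: (HS n) => HL _; rewrite (linear_plus _ HL).
  refine (filterlim_comp_2 _ _ (fun x y => plus x y) (strong_limit_correct x) (strong_limit_correct y) _).
  exact: filterlim_plus.
- apply: strong_limit_unique.
  apply: (filterlim_ext (fun n => scal d (S n x))) => [n|].
    by case: (HS n) => HL _; rewrite (linear_scal _ HL).
  case: (op_bound_scal (fun x : V => x) 1 d op_bound_id) => HL _.
  exact: (linear_limit _ HL _ _ (strong_limit_correct x)).
- by case: (HS 0%nat) => _ [].
- apply: (limit_norm_le _ _ _ (strong_limit_correct x)) => n.
  by case: (HS n) => _ [].
Qed.

Lemma strong_limit_commutes R : is_linear R -> (forall n, commutes (S n) R) ->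
  commutes strong_limit R.
Proof using Hconv.
move=> HR HC x; apply: strong_limit_unique.
apply: (filterlim_ext (fun n => R (S n x))) => [n|]; first by rewrite HC.
refine (linear_limit R HR _ _ (strong_limit_correct x)).
Qed.
End StrongLimit.

Section Decomposition.
Context {V : CompleteNormedModule C_AbsRing} (N : V -> V) (E : nat -> V -> V) (c : R) (k : nat).
Hypothesis HN : is_linear N.
Hypothesis HE : forall n, op_bound (E n) c.
Hypothesis HC : forall n, commutes (E n) N.
Hypothesis Hlim : forall h,
  filterlim (fun n => Nat.iter (S k) N (E n h)) eventually (locally (Nat.iter k N h)).

Let c0 : 0 <= c.
Proof. by case: (HE 0%nat) => _ []. Qed.

(** Iterating [N^k = lim N^(k+1) E_n] inside itself. *)
Lemma power_limit j h :
  filterlim (fun n => Nat.iter (j + k) N (Nat.iter j (E n) h)) eventually (locally (Nat.iter k N h)).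
Proof using HN HE HC Hlim.
case: (op_bound_exists N HN) => d Hd.
elim: j => [|j IH]; first exact: filterlim_const.
have Hj n : op_bound (fun x => Nat.iter j N (Nat.iter j (E n) x)) (d ^ j * c ^ j).
  by apply: op_bound_comp; apply: op_bound_iter.
apply: (filterlim_ext (fun n => Nat.iter j N (Nat.iter j (E n) (Nat.iter (S k) N (E n h))))) => [n|].
  rewrite -(commutes_iter _ _ j (commutes_sym _ _ (commutes_iter _ _ (S k) (HC n)))) -Nat.iter_add.
  by rewrite -Nat.iter_succ_r Nat.add_succ_r.
apply: (uniform_limit _ _ _ _ _ Hj (Hlim h)).
apply: filterlim_ext IH => n.
by rewrite -(commutes_iter _ _ j (commutes_sym _ _ (commutes_iter _ _ k (HC n)))) -Nat.iter_add.
Qed.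

(* The approximations [N^k E_n^k] converge strongly to the projection [Q] onto the
   closure of the range of [N^k], along the kernel of [N^k]. *)
Let Q_ n h := Nat.iter k N (Nat.iter k (E n) h).

Lemma Q_commutes n : commutes (Q_ n) N.
Proof using HC.
move=> x; rewrite /Q_ -(commutes_iter _ _ k (commutes_sym _ _ (HC n))).
by rewrite -Nat.iter_succ_r.
Qed.

(** Since [N^k h] is the limit of [E_n^k (N^(2k) h)]. *)
Lemma bounded_below_on_range h :
  norm (Nat.iter k N h) <= c ^ k * norm (Nat.iter (k + k) N h).
Proof using HN HE HC Hlim.
apply: (limit_norm_le _ _ _ (power_limit k h)) => n.
rewrite (commutes_iter _ _ k (commutes_sym _ _ (commutes_iter _ _ (k + k) (HC n)))).
by case: (op_bound_iter _ _ k (HE n)) => _ [].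
Qed.

Lemma Q_bound : exists q, forall n, op_bound (Q_ n) q.
Proof using HN HE.
case: (op_bound_exists N HN) => d Hd; exists (d ^ k * c ^ k) => n.
by apply: op_bound_comp; apply: op_bound_iter.
Qed.

(** Differences of the approximations lie in the range of [N^k], where [N^k] is
    bounded below, and [N^k Q_n h = N^(2k) E_n^k h] converges. *)
Lemma Q_converges h : exists l, filterlim (fun n => Q_ n h) eventually (locally l).
Proof using HN HE HC Hlim.
case: (op_bound_exists N HN) => d Hd.
apply: (cauchy_by_domination _ _ _ (c ^ k) _ (power_limit k h)); first exact: pow_le.
move=> m n; case: (op_bound_iter _ _ k Hd) => HLk _.
case: (op_bound_iter _ _ (k + k) Hd) => HL2k _.
rewrite /Q_ -(linear_minus _ _ _ HLk) -(linear_minus _ _ _ HL2k).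
exact: bounded_below_on_range.
Qed.

Let Q := strong_limit Q_.

(** The projection onto the generalized kernel of [N], which is the kernel of
    [N^k]. *)
Definition kernel_projection (h : V) : V := minus h (Q h).

Lemma Q_linear : is_linear Q.
Proof using HN HE HC Hlim.
case: Q_bound => q Hq.
by case: (strong_limit_bound _ _ Hq Q_converges).
Qed.

Lemma Q_iter h : Nat.iter k N (Q h) = Nat.iter k N h.
Proof using HN HE HC Hlim.
case: (op_bound_exists N HN) => d Hd; case: (op_bound_iter _ _ k Hd) => HLk _.
have L1 := linear_limit _ HLk _ _ (strong_limit_correct _ Q_converges h).
have L2 : filterlim (fun n => Nat.iter k N (Q_ n h)) eventually (locally (Nat.iter k N h)).
  by apply: filterlim_ext (power_limit k h) => n; apply: Nat.iter_add.
exact: (limit_unique (V := V) _ _ _ L1 L2).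
Qed.

Lemma Q_N : commutes Q N.
Proof using HN HE HC Hlim.
exact: (strong_limit_commutes _ Q_converges N HN Q_commutes).
Qed.

Lemma kernel_projection_linear : is_linear kernel_projection.
Proof using HN HE HC Hlim.
case: (op_bound_exists _ Q_linear) => q Hq.
case: (op_bound_plus _ _ _ _ op_bound_id (op_bound_scal _ _ (Copp (RtoC 1)) Hq)) => HL _.
have -> : kernel_projection = (fun x => plus x (scal (Copp (RtoC 1)) (Q x))) => //.
by apply: functional_extensionality => x; rewrite /kernel_projection; module_eq.
Qed.

Lemma kernel_projection_commutes : commutes kernel_projection N.
Proof using HN HE HC Hlim.
by move=> x; rewrite /kernel_projection (linear_minus _ _ _ HN) Q_N.
Qed.

Lemma kernel_projection_kernel h : Nat.iter k N (kernel_projection h) = zero.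
Proof using HN HE HC Hlim.
case: (op_bound_exists N HN) => d Hd; case: (op_bound_iter _ _ k Hd) => HLk _.
rewrite /kernel_projection (linear_minus _ _ _ HLk) Q_iter; module_eq.
Qed.

Lemma kernel_projection_idem h :
  kernel_projection (kernel_projection h) = kernel_projection h.
Proof using HN HE HC Hlim.
have HQ : Q (Q h) = Q h.
  have L1 := linear_limit _ Q_linear _ _ (strong_limit_correct _ Q_converges h).
  have L2 : filterlim (fun n => Q (Q_ n h)) eventually (locally (Q h)).
    apply: filterlim_ext (strong_limit_correct _ Q_converges h) => n.
    by rewrite /Q_ (commutes_iter _ _ k Q_N) Q_iter.
  exact: (limit_unique (V := V) _ _ _ L1 L2).
rewrite /kernel_projection (linear_minus _ _ _ Q_linear) HQ; module_eq.
Qed.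

(** If the generalized kernel is trivial, [N] is bounded below and its right
    approximate inverses [E n] converge. *)
Lemma invertible_of_trivial_kernel :
  (forall h, kernel_projection h = zero) ->
  exists S, is_linear S /\ (forall h, N (S h) = h) /\ (forall h, S (N h) = h).
Proof using HN HE HC Hlim.
move=> HP.
case: (op_bound_exists N HN) => d Hd; case: (op_bound_iter _ _ k Hd) => HLk _.
have HQ h : Q h = h by symmetry; apply: minus_zero_eq; exact: HP.
have Hk h : norm h <= c ^ k * norm (Nat.iter k N h).
  apply: (limit_norm_le (fun n => Q_ n h)) => [|n].
    by rewrite -{2}(HQ h); apply: strong_limit_correct Q_converges h.
  rewrite /Q_ (commutes_iter _ _ k (commutes_sym _ _ (commutes_iter _ _ k (HC n)))).
  by case: (op_bound_iter _ _ k (HE n)) => _ [].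
have HNE h : filterlim (fun n => N (E n h)) eventually (locally h).
  apply/limit_dist.
  apply: (is_lim_seq_le_le (fun _ => 0) _
    (fun n => c ^ k * norm (minus (Nat.iter (S k) N (E n h)) (Nat.iter k N h)))).
  - move=> n; split; first exact: norm_ge_0.
    by rewrite Nat.iter_succ_r -(linear_minus _ _ _ HLk); apply: Hk.
  - exact: is_lim_seq_const.
  rewrite (_ : Finite 0 = Finite (c ^ k * 0)); last by congr Finite; ring.
  apply: (is_lim_seq_mult' _ _ _ _ (is_lim_seq_const _)).
  by apply/limit_dist; apply: Hlim.
have HNb h : norm h <= c * norm (N h).
  apply: (limit_norm_le _ _ _ (HNE h)) => n.
  by rewrite -HC; case: (HE n) => _ [].
have Hconv h : exists l, filterlim (fun n => E n h) eventually (locally l).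
  apply: (cauchy_by_domination _ _ _ c c0 (HNE h)) => m n.
  by rewrite -(linear_minus _ _ _ HN); apply: HNb.
exists (strong_limit E).
have HNS h : N (strong_limit E h) = h.
  have L1 := linear_limit N HN _ _ (strong_limit_correct _ Hconv h).
  exact: (limit_unique (V := V) _ _ _ L1 (HNE h)).
split; first by case: (strong_limit_bound _ _ HE Hconv).
split=> // h.
by rewrite (strong_limit_commutes _ Hconv N HN HC).
Qed.
End Decomposition.

(** * Nilpotents and commutators *)

(** The finite-dimensional fact that the identity is not a commutator [N L - L N]
    with [N] nilpotent, on the range of the projection [P]. *)
Lemma commutator_with_nilpotent {V : NormedModule C_AbsRing} (N P L : V -> V) k :
  is_linear N -> is_linear P -> is_linear L ->
  commutes P N -> (forall h, P (P h) = P h) ->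
  (forall h, Nat.iter k N (P h) = zero) ->
  (forall h, P h = minus (N (L h)) (L (N h))) ->
  forall h, P h = zero.
Proof.
move=> HN HP HL HC Hidem Hk Hcomm.
(* [ad L] is a derivation and [P] commutes with [N]. *)
have Hpow j h : minus (Nat.iter (S j) N (L h)) (L (Nat.iter (S j) N h))
    = scal (RtoC (INR (S j))) (Nat.iter j N (P h)).
  elim: j => [|j IH]; first by rewrite /= Hcomm; module_eq.
  have -> : minus (Nat.iter (S (S j)) N (L h)) (L (Nat.iter (S (S j)) N h))
    = plus (N (minus (Nat.iter (S j) N (L h)) (L (Nat.iter (S j) N h)))) (P (Nat.iter (S j) N h)).
    by rewrite Hcomm (linear_minus _ _ _ HN) /=; module_eq.
  rewrite IH (linear_scal _ HN) (commutes_iter _ _ (S j) HC) /= -/(INR (S j)).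
  rewrite (_ : RtoC (_ + 1) = Cplus (RtoC (INR (S j))) (RtoC 1)); last by rewrite -RtoC_plus.
  module_eq.
elim: k Hk => [//|j IH] Hk; apply: IH => h.
(* The left-hand side dies between two copies of [P]. *)
have Hsandwich : scal (RtoC (INR (S j))) (Nat.iter j N (P h)) = zero.
  have := f_equal P (Hpow j (P h)).
  rewrite (linear_minus _ _ _ HP) (linear_scal _ HP) !(commutes_iter _ _ _ HC) !Hidem.
  rewrite !Hk (linear_zero _ HL) (linear_zero _ HP) => <-; module_eq.
have Hj : RtoC (INR (S j)) <> RtoC 0 by move/RtoC_inj; apply: not_0_INR.
have -> : Nat.iter j N (P h) = scal (Cinv (RtoC (INR (S j)))) (scal (RtoC (INR (S j))) (Nat.iter j N (P h))).
  by module_eq_with ltac:(field; exact Hj).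
by rewrite Hsandwich; apply: scal_zero_r.
Qed.

(** * The extension attached to a projection *)

Definition truncate (a : nat -> C) (d k : nat) : C :=
  if Nat.leb k d then a k else RtoC 0.

Lemma poly_apply_truncate {V : NormedModule C_AbsRing} a d (T : V -> V) h :
  poly_apply (truncate a d) d T h = poly_apply a d T h.
Proof.
apply: sum_n_ext_loc => k Hk; rewrite /truncate.
by case: Nat.leb_spec => //; lia.
Qed.

Lemma poly_eval_truncate a d z : poly_eval (truncate a d) d z = poly_eval a d z.
Proof.
apply: sum_n_ext_loc => k Hk; rewrite /truncate.
by case: Nat.leb_spec => //; lia.
Qed.

Lemma disc_series_finite a d : (forall k, (d < k)%nat -> a k = RtoC 0) -> disc_series a.
Proof.
move=> H0 R HR; exists (sum_n (fun k => Cmod (a k)) d) => n.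
have Hn : 0 <= R ^ n <= 1.
  split; first by apply: pow_le; lra.
  by rewrite -(pow1 n); apply: pow_incr; lra.
have Hpos m : 0 <= sum_n (fun k => Cmod (a k)) m.
  elim: m => [|m IH]; first by rewrite sum_O; apply: Cmod_ge_0.
  by rewrite sum_Sn /plus /=; have := Cmod_ge_0 (a (S m)); lra.
have Hle m : (n <= m)%nat -> Cmod (a n) <= sum_n (fun k => Cmod (a k)) m.
  elim: m => [|m IH] Hnm.
    by rewrite sum_O (_ : n = 0%nat); [lra|lia].
  rewrite sum_Sn /plus /=; case: (Nat.eq_dec n (S m)) => [->|Hne].
    have := Hpos m; lra.
  have := IH ltac:(lia); have := Cmod_ge_0 (a (S m)); lra.
case: (Nat.le_gt_cases n d) => Hnd.
  have := Hle d Hnd; have := Cmod_ge_0 (a n); nra.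
by rewrite H0 // Cmod_0 Rmult_0_l.
Qed.

Lemma eval_finite a d z : (forall k, (d < k)%nat -> a k = RtoC 0) ->
  eval_series a z = poly_eval a d z.
Proof.
move=> H0; apply: eval_unique; rewrite /is_series /poly_eval.
apply: (filterlim_ext_loc (fun _ => sum_n (fun k => Cmult (a k) (Cpow z k) : C_NormedModule) d)).
  exists d => n Hn; rewrite -(Nat.sub_add d n Hn) Nat.add_comm.
  elim: (n - d)%nat => [|m IH]; first by rewrite Nat.add_0_r.
  rewrite Nat.add_succ_r sum_Sn -IH H0; last lia.
  by rewrite Cmult_0_l plus_zero_r.
exact: filterlim_const.
Qed.

Section PolynomialDivision.
Context {V : NormedModule C_AbsRing} (U : V -> V) (HU : is_linear U).

Lemma poly_apply_affine p q b d y :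
  plus (poly_apply (coef_affine p q b) d U y) (scal (Cmult q (b d)) (Nat.iter (S d) U y))
  = poly_apply b d U (affine p q U y).
Proof using HU.
case: (op_bound_exists U HU) => u Hu.
elim: d => [|d IH]; first by rewrite /poly_apply !sum_O /affine /=; module_eq.
move: IH; rewrite /poly_apply !sum_Sn => <-.
case: (op_bound_iter _ _ (S d) Hu) => HL _.
rewrite /affine (linear_plus _ HL) !(linear_scal _ HL) -Nat.iter_succ_r.
rewrite /coef_affine; module_eq.
Qed.

End PolynomialDivision.

Definition poly_bounded_by (a : nat -> C) (d : nat) (s : R) :=
  forall z, Cmod z < 1 -> Cmod (poly_eval a d z) <= s.

(** A polynomial is a power series with finitely many coefficients, so its
    quotient by [z - c] inherits the bound for bounded analytic functions. *)
Lemma poly_division c a d s : Cmod c < 1 -> poly_bounded_by a d s ->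
  exists b, poly_bounded_by b d (2 * s / (1 - Cmod c)) /\
    forall (V : NormedModule C_AbsRing) (U : V -> V) y, is_linear U ->
      poly_apply a d U y
      = plus (scal (poly_eval a d c) y) (poly_apply b d U (affine (Copp c) (RtoC 1) U y)).
Proof.
move=> Hc Hs.
have H0 k : (d < k)%nat -> truncate a d k = RtoC 0.
  by rewrite /truncate; case: Nat.leb_spec => //; lia.
have Ha := disc_series_finite _ _ H0.
have Hb := quotient_finite c _ d Ha H0.
exists (quotient c (truncate a d)); split.
  move=> z Hz.
  have -> : poly_eval (quotient c (truncate a d)) d z = eval_series (quotient c (truncate a d)) z.
    by symmetry; apply: eval_finite => k Hk; apply: Hb; lia.
  have Hbd : disc_bounded (truncate a d) s.
    by split=> // w Hw; rewrite (eval_finite _ d) // poly_eval_truncate; apply: Hs.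
  by case: (quotient_bounded c _ s Hc Hbd) => _; apply.
move=> V U y HU.
rewrite -(poly_apply_affine U HU) (Hb d) // quotient_spec // poly_apply_sub_const.
rewrite (eval_finite _ d) // poly_eval_truncate poly_apply_truncate.
module_eq.
Qed.

Section Cocycle.
Context {H : HilbertSpace} (T P : H -> H) (c : C) (k : nat).
Hypothesis Hc : Cmod c < 1.
Hypothesis HT : op_bound T 1.
Hypothesis HP : is_linear P.
Hypothesis HPT : commutes P T.
Let N := affine (Copp c) (RtoC 1) T.
Hypothesis HPk : forall h, Nat.iter k N (P h) = zero.

Let K : NormedModule C_AbsRing := prod_NormedModule C_AbsRing H H.
Let U : K -> K := upper_triangular T P T.
Let D := affine (Copp c) (RtoC 1) U.

Lemma norm_pair_bounds (x : K) :
  norm (fst x) <= norm x /\ norm (snd x) <= norm x /\ norm x <= norm (fst x) + norm (snd x).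
Proof.
have -> : norm x = sqrt (norm (fst x) ^ 2 + norm (snd x) ^ 2) by [].
have := norm_ge_0 (fst x); have := norm_ge_0 (snd x).
move: (norm (fst x)) (norm (snd x)) => u v v0 u0.
split; last split.
- by rewrite -{1}(sqrt_pow2 u u0); apply: sqrt_le_1_alt; nra.
- by rewrite -{1}(sqrt_pow2 v v0); apply: sqrt_le_1_alt; nra.
- by rewrite -(sqrt_pow2 (u + v)); [apply: sqrt_le_1_alt; nra|lra].
Qed.

Lemma upper_triangular_linear : is_linear U.
Proof using HT HP.
case: (HT) => HL [_ Hb]; case: (op_bound_exists P HP) => p [_ [p0 Hp]].
case: (op_bound_intro U (1 + p + 1)) => //.
- move=> [x1 x2] [y1 y2].
  change (pair (plus (T (plus x1 y1)) (P (plus x2 y2))) (T (plus x2 y2))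
    = pair (plus (plus (T x1) (P x2)) (plus (T y1) (P y2))) (plus (T x2) (T y2))).
  by rewrite !(linear_plus T HL) (linear_plus P HP); congr pair; module_eq.
- move=> w [x1 x2].
  change (pair (plus (T (scal w x1)) (P (scal w x2))) (T (scal w x2))
    = pair (scal w (plus (T x1) (P x2))) (scal w (T x2))).
  by rewrite !(linear_scal T HL) (linear_scal P HP); congr pair; module_eq.
- lra.
- move=> [x1 x2]; case: (norm_pair_bounds (x1, x2)) => H1 [H2 _].
  case: (norm_pair_bounds (U (x1, x2))) => _ [_ H3]; apply: Rle_trans H3 _.
  set n := norm ((x1, x2) : K).
  have B1 : norm (plus (T x1) (P x2)) <= norm x1 + p * norm x2.
    apply: Rle_trans (norm_triangle _ _) _.
    have := Hb x1; have := Hp x2; lra.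
  have B2 : norm (T x2) <= norm x2 by have := Hb x2; lra.
  have B3 : norm x1 <= n := H1; have B4 : norm x2 <= n := H2.
  apply: Rle_trans (Rplus_le_compat _ _ _ _ B1 B2) _.
  have := Rmult_le_compat_l _ _ _ p0 B4; lra.
Qed.

Lemma D_pair x y : D (x, y) = (plus (N x) (P y), N y).
Proof.
rewrite /D /N /affine /U /upper_triangular.
change (pair (plus (scal (Copp c) x) (scal (RtoC 1) (plus (T x) (P y)))) (plus (scal (Copp c) y) (scal (RtoC 1) (T y)))
  = pair (plus (plus (scal (Copp c) x) (scal (RtoC 1) (T x))) (P y)) (plus (scal (Copp c) y) (scal (RtoC 1) (T y)))).
congr pair; module_eq.
Qed.

(** Because [P] commutes with [N], the corner of a power of [D] is the derivative
    of that power, times [P]. *)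
Lemma D_iter i x y :
  Nat.iter (S i) D (x, y) =
  (plus (Nat.iter (S i) N x) (scal (RtoC (INR (S i))) (Nat.iter i N (P y))), Nat.iter (S i) N y).
Proof using HT HP HPT.
have HN : is_linear N by case: (op_bound_affine T 1 (Copp c) (RtoC 1) HT).
have HPN : commutes P N by apply: commutes_affine.
elim: i => [|i IH].
  by change (D (x, y) = (plus (N x) (scal (RtoC 1) (P y)), N y)); rewrite D_pair; congr pair; module_eq.
rewrite Nat.iter_succ IH D_pair (linear_plus N HN) (linear_scal N HN) (commutes_iter _ _ (S i) HPN).
congr pair.
rewrite (_ : RtoC (INR (S (S i))) = Cplus (RtoC (INR (S i))) (RtoC 1)); last by rewrite -RtoC_plus -S_INR.
rewrite !(Nat.iter_succ _ _ N).
module_eq.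
Qed.

(** With [D = U - c], the power [D^(k+1)] is diagonal, and [U] acts diagonally
    on its range, where von Neumann's inequality for [T] applies. Each division
    of the polynomial by [z - c] then lowers the power of [D] by one. *)
Lemma upper_triangular_polynomially_bounded :
  polynomially_bounded (V := prod_NormedModule C_AbsRing H H) (upper_triangular T P T).
Proof using HT HP HPT HPk Hc.
have HU := upper_triangular_linear.
have HN : is_linear N by case: (op_bound_affine T 1 (Copp c) (RtoC 1) HT).
have HPN : commutes P N by apply: commutes_affine.
case: (op_bound_exists U HU) => u Hu.
pose e := Cmod (Copp c) * 1 + Cmod (RtoC 1) * u.
have HD : op_bound D e by apply: op_bound_affine.
pose bound i M := 0 <= M /\ forall a d s x, poly_bounded_by a d s -> 0 <= s ->
  norm (poly_apply a d U (Nat.iter i D x)) <= M * s * norm x.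
have Htop : exists M, bound (S k) M.
  exists (2 * e ^ S k); split.
    case: HD => _ [e0 _]; have := pow_le e (S k) e0; lra.
  move=> a d s [x y] Hs s0.
  have Ew : Nat.iter (S k) D (x, y) = (Nat.iter (S k) N x, Nat.iter (S k) N y).
    by rewrite D_iter HPk; congr pair; module_eq.
  have Hw : norm (Nat.iter (S k) D (x, y)) <= e ^ S k * norm ((x, y) : K).
    by case: (op_bound_iter _ _ (S k) HD) => _ [_]; apply.
  move: Ew Hw; move: (Nat.iter (S k) D (x, y)) => [w1 w2] [_ E2] Hw.
  have HUw j : Nat.iter j U (w1, w2) = (Nat.iter j T w1, Nat.iter j T w2).
    elim: j => [//|j IH].
    rewrite !Nat.iter_succ IH {1}/U /upper_triangular; congr pair.
    change (plus (T (Nat.iter j T w1)) (P (Nat.iter j T w2)) = T (Nat.iter j T w1)).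
    rewrite (commutes_iter _ _ j HPT) E2 (commutes_iter _ _ (S k) HPN) Nat.iter_succ HPk.
    case: (HT) => HL _; case: (op_bound_iter _ _ j HT) => HLj _.
    by rewrite (linear_zero _ HN) (linear_zero _ HLj); module_eq.
  have Ep : poly_apply a d U (w1, w2) = (poly_apply a d T w1, poly_apply a d T w2).
    rewrite /poly_apply; elim: d {Hs} => [|d IH]; first by rewrite !sum_O HUw.
    by rewrite !sum_Sn IH HUw.
  rewrite Ep.
  case: (norm_pair_bounds (poly_apply a d T w1, poly_apply a d T w2)) => _ [_ H3].
  apply: Rle_trans H3 _.
  case: (norm_pair_bounds (w1, w2)) => H1 [H2 _].
  have B1 := Rle_trans _ _ _ (von_neumann_contraction T a d s w1 HT Hs) (Rmult_le_compat_l _ _ _ s0 H1).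
  have B2 := Rle_trans _ _ _ (von_neumann_contraction T a d s w2 HT Hs) (Rmult_le_compat_l _ _ _ s0 H2).
  apply: Rle_trans (Rplus_le_compat _ _ _ _ B1 B2) _.
  have := Rmult_le_compat_l _ _ _ s0 Hw; lra.
have Hstep i : (exists M, bound (S i) M) -> exists M, bound i M.
  move=> [M [M0 HM]].
  have Hq : 0 < / (1 - Cmod c) by apply: Rinv_0_lt_compat; lra.
  case: (op_bound_iter _ _ i HD) => _ [ei0 Hi].
  exists (e ^ i + M * (2 / (1 - Cmod c))); split.
    by have : 0 <= M * (2 / (1 - Cmod c)) by [apply: Rmult_le_pos => //; rewrite /Rdiv; lra]; lra.
  move=> a d s x Hs s0.
  case: (poly_division c a d s Hc Hs) => b [Hb Hdiv].
  rewrite Hdiv // -/D -Nat.iter_succ.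
  apply: Rle_trans (norm_triangle _ _) _.
  have Hs' : 0 <= 2 * s / (1 - Cmod c) by apply: Rmult_le_pos; lra.
  have := HM b d _ x Hb Hs'.
  rewrite norm_scal_C.
  have := Rmult_le_compat _ _ _ _ (Cmod_ge_0 _) (norm_ge_0 _) (Hs c Hc) (Hi x).
  by rewrite /Rdiv; lra.
have [M [M0 HM]] : exists M, bound 0%nat M.
  move: Htop; elim: (S k) => [//|i IH] Hi; exact: IH (Hstep i Hi).
exists (M + 1); split; first lra.
move=> a d s [Hub _] h.
have Hs : poly_bounded_by a d s.
  by move=> z Hz; apply: Hub; exists z.
have s0 : 0 <= s.
  by apply: poly_eval_bound_ge_0 (Hs (RtoC 0) _); rewrite Cmod_0; lra.
apply: Rle_trans (HM a d s h Hs s0) _.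
apply: Rmult_le_compat_r; first exact: norm_ge_0.
by apply: Rmult_le_compat_r; lra.
Qed.
End Cocycle.

(** * Operators of class C_0 *)

(** The terms of a convergent series are bounded. *)
Lemma disc_series_of_taylor u a : taylor_coefficients u a -> disc_series a.
Proof.
move=> Ht R HR.
have HR1 : Cmod (RtoC R) < 1 by rewrite Cmod_R Rabs_pos_eq; lra.
have Hs := Ht _ HR1.
case: (filterlim_bounded (K := C_AbsRing) _ (ex_intro _ _ Hs)) => M HM.
have Hterm n : norm (scal (pow_n (K := C_AbsRing) (RtoC R) n) (a n) : C_NormedModule) = Cmod (a n) * R ^ n.
  rewrite norm_scal_C Rmult_comm; congr (_ * _).
  by rewrite pow_n_Cpow Cmod_pow Cmod_R Rabs_pos_eq; lra.
have HM0 : 0 <= M by apply: Rle_trans (norm_ge_0 _) (HM 0%nat).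
exists (M + M) => -[|n]; rewrite -Hterm.
  apply: Rle_trans (_ : M <= M + M); last lra.
  by have := HM 0%nat; rewrite sum_O.
pose y m := sum_n (fun k => scal (pow_n (K := C_AbsRing) (RtoC R) k) (a k) : C_NormedModule) m.
have -> : scal (pow_n (K := C_AbsRing) (RtoC R) (S n)) (a (S n)) = minus (y (S n)) (y n).
  by rewrite /y sum_Sn; module_eq.
apply: Rle_trans (norm_minus_triangle _ _) _.
exact: Rplus_le_compat (HM (S n)) (HM n).
Qed.

Lemma eval_taylor u a z : taylor_coefficients u a -> Cmod z < 1 -> eval_series a z = u z.
Proof.
move=> Ht Hz; apply: eval_unique; apply: is_series_ext (Ht z Hz) => n.
by rewrite pow_n_Cpow; exact: Cmult_comm.
Qed.

Lemma radius_at_left : filterlim radius eventually (at_left 1).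
Proof.
move=> Q [eps Heps].
have := proj2 (is_lim_seq_spec _ _) radius_lim eps; apply: filter_imp => n Hn.
by apply: Heps; [exact: Hn|case: (radius_bounds n)].
Qed.

Section ClassC0.
Context {H : HilbertSpace} (T : H -> H) (c : C).
Hypothesis HT : op_bound T 1.
Hypothesis Hc : Cmod c < 1.

Let N := affine (Copp c) (RtoC 1) T.

Definition dilate (r : R) (x : H) : H := scal (RtoC r) (T x).

Lemma dilate_bound r : 0 < r < 1 -> op_bound (dilate r) r.
Proof using HT.
move=> Hr; have := op_bound_scal _ _ (RtoC r) HT.
by rewrite Cmod_R Rabs_pos_eq ?Rmult_1_r //; lra.
Qed.

Lemma affine_bound_2 r p q : 0 <= r <= 1 -> Cmod p <= 1 -> Cmod q <= 1 ->
  forall S : H -> H, op_bound S r -> op_bound (affine p q S) 2.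
Proof.
move=> Hr Hp Hq S HS; case: (op_bound_affine S r p q HS) => HL [_ Hb].
split=> //; split; first lra.
move=> x; apply: Rle_trans (Hb x) _; apply: Rmult_le_compat_r; first exact: norm_ge_0.
have q0 := Cmod_ge_0 q.
have : Cmod q * r <= 1 * 1 by apply: Rmult_le_compat; lra.
lra.
Qed.

(** The functional calculus is defined through [r T], while the conclusions
    concern [T] itself; the difference is of order [1 - r], uniformly on bounded
    sets. *)
Lemma dilate_power_dist j : exists D, 0 <= D /\ forall r y, 0 < r < 1 ->
  norm (minus (Nat.iter j N y) (Nat.iter j (affine (Copp c) (RtoC 1) (dilate r)) y))
  <= D * (1 - r) * norm y.
Proof using HT Hc.
have Hc1 : Cmod (Copp c) <= 1 by rewrite Cmod_opp; lra.
have H1 : Cmod (RtoC 1) <= 1 by rewrite Cmod_1; lra.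
elim: j => [|j [D [D0 IH]]].
  exists 0; split; first lra.
  move=> r y Hr /=; rewrite (_ : minus y y = zero); last by module_eq.
  by rewrite norm_zero; lra.
exists (2 ^ j + 2 * D); split; first by have := pow_le 2 j; lra.
move=> r y Hr; have Hr' : 0 <= r <= 1 by lra.
have HNr := affine_bound_2 r _ _ Hr' Hc1 H1 _ (dilate_bound r Hr).
have H11 : 0 <= 1 <= 1 by lra.
have HN := affine_bound_2 1 _ _ H11 Hc1 H1 _ HT.
case: (op_bound_iter _ _ j HN) => _ [_ /(_ y) HNj].
case: HNr => HLr [_ Hbr].
rewrite !Nat.iter_succ.
move: HNj (IH r y Hr); rewrite -/N.
move: (Nat.iter j N y) (Nat.iter j (affine _ _ (dilate r)) y) => x z Hx Hxz.
have -> : minus (N x) (affine (Copp c) (RtoC 1) (dilate r) z)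
  = plus (scal (RtoC (1 - r)) (T x)) (affine (Copp c) (RtoC 1) (dilate r) (minus x z)).
  rewrite (linear_minus _ _ _ HLr) /N /affine /dilate RtoC_minus; module_eq.
apply: Rle_trans (norm_triangle _ _) _.
rewrite norm_scal_C Cmod_R Rabs_pos_eq; last lra.
have := Hbr (minus x z).
case: HT => _ [_ /(_ x) HTx].
have Hr1 : 0 <= 1 - r by lra.
have := Rmult_le_compat_l _ _ _ Hr1 (Rle_trans _ _ _ HTx (Rmult_le_compat_l _ _ _ Rle_0_1 Hx)).
lra.
Qed.

(** From [u(T) = 0] and [u = b^k v], [v(c) <> 0], where [b] is the Blaschke
    factor at [c]: dividing, [v = v(c) + (z - c) g], so that the operators
    [E = - g(rT) / v(c)] satisfy [(T - c)^k (1 - (T - c) E) -> 0] strongly. *)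
Lemma approximate_inverses u a (F : R -> H -> H) B z0 :
  taylor_coefficients u a ->
  (forall z, Cmod z < 1 -> Cmod (u z) <= B) ->
  Cmod z0 < 1 -> u z0 <> RtoC 0 ->
  (forall r h, 0 <= r < 1 -> is_pseries (fun n => scal (a n) (Nat.iter n T h) : H) (RtoC r) (F r h)) ->
  (forall h, filterlim (fun r => F r h) (at_left 1) (locally (zero : H))) ->
  exists k e (E : nat -> H -> H), (forall n, op_bound (E n) e) /\
    (forall n, commutes (E n) T) /\
    forall h, filterlim (fun n => Nat.iter (S k) N (E n h)) eventually (locally (Nat.iter k N h)).
Proof using HT Hc.
move=> Hu HB Hz0 Hne HF Hlim.
have Ha := disc_series_of_taylor u a Hu.
have Hab : disc_bounded a B.
  by split=> // z Hz; rewrite (eval_taylor u) //; apply: HB.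
have Hne' : eval_series a z0 <> RtoC 0 by rewrite (eval_taylor u).
case: (finite_order c a B z0 Hc Hab Hz0 Hne') => k [v [Hv [Hv0 Hrel]]].
have [Hvd _] := Hv.
set v0 := eval_series v c in Hv0.
have [Hg Hgb] := quotient_bounded c v B Hc Hv.
set g := quotient c v in Hg Hgb.
set gam := 2 * B / (1 - Cmod c) in Hgb.
have gam0 : 0 <= gam.
  have := Hgb (RtoC 0); have := Cmod_ge_0 (eval_series g (RtoC 0)).
  by rewrite Cmod_0; lra.
pose S n := dilate (radius n).
have HS n : op_bound (S n) (radius n) by apply/dilate_bound/radius_bounds.
have Hr1 n : radius n < 1 by case: (radius_bounds n).
pose G n := opseries g (S n).
have HG n : op_bound (G n) gam.
  have Hr := radius_bounds n.
  apply: op_bound_intro => // [x y|w x|x].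
  - exact: (opseries_plus _ _ (HS n) (Hr1 n)).
  - exact: (opseries_scal _ _ (HS n) (Hr1 n)).
  - apply: (von_neumann_series _ _ ((radius n + 1) / 2) (HS n)) => //; try lra.
    by move=> z Hz; apply: Hgb; lra.
case: (HT) => HL _.
have HST n : commutes T (S n).
  by move=> x; rewrite /S /dilate (linear_scal T HL).
pose E n h := scal (Copp (Cinv v0)) (G n h).
exists k, (Cmod (Copp (Cinv v0)) * gam), E; split; last split.
- by move=> n; apply: op_bound_scal.
- move=> n x; rewrite /E (linear_scal T HL); congr (scal _ _).
  exact: (opseries_commutes _ _ (HS n) (Hr1 n)).
move=> h; apply/limit_dist.
have Hc1 : Cmod (Copp c) <= 1 by rewrite Cmod_opp; lra.
have Hcc1 : Cmod (Copp (Cconj c)) <= 1 by rewrite Cmod_opp Cmod_conj; lra.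
have H1 : Cmod (RtoC 1) <= 1 by rewrite Cmod_1; lra.
have HFn n : opseries a (S n) h = F (radius n) h.
  apply: opseries_unique.
  have Hr : 0 <= radius n < 1 by case: (radius_bounds n); lra.
  apply: is_series_ext (HF _ h Hr) => m.
  by rewrite pow_n_Cpow /S /dilate iter_scal //; module_eq.
have Hkey n : minus h (affine (Copp c) (RtoC 1) (S n) (E n h)) = scal (Cinv v0) (opseries v (S n) h).
  have Eg : affine (Copp c) (RtoC 1) (S n) (G n h) = minus (opseries v (S n) h) (scal v0 h).
    rewrite /G -(opseries_affine _ _ _ _ _ _ (HS n)) // quotient_spec //.
    exact: (opseries_sub_const _ _ _ _ _ (HS n)).
  have [HLa _] := op_bound_affine (S n) _ (Copp c) (RtoC 1) (HS n).
  by rewrite /E (linear_scal _ HLa) Eg; module_eq_with ltac:(field; exact Hv0).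
have Hsmall n : norm (Nat.iter k (affine (Copp c) (RtoC 1) (S n)) (minus h (affine (Copp c) (RtoC 1) (S n) (E n h))))
    <= Cmod (Cinv v0) * 2 ^ k * norm (F (radius n) h).
  rewrite Hkey -HFn.
  have [HLa _] := op_bound_iter _ _ k (op_bound_affine (S n) _ (Copp c) (RtoC 1) (HS n)).
  rewrite (linear_scal _ HLa) norm_scal_C Rmult_assoc.
  apply: Rmult_le_compat_l; first exact: Cmod_ge_0.
  rewrite -(opseries_iter _ _ _ _ _ _ _ (HS n)) // -Hrel (opseries_iter _ _ _ _ _ _ _ (HS n)) //.
  have Hr : 0 <= radius n <= 1 by case: (radius_bounds n); lra.
  have HB2 := affine_bound_2 _ _ _ Hr H1 Hcc1 _ (HS n).
  by case: (op_bound_iter _ _ k HB2) => _ [_]; apply.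
case: (dilate_power_dist k) => D [D0 HD].
case: (dilate_power_dist (Datatypes.S k)) => D' [D'0 HD'].
pose ce := Cmod (Copp (Cinv v0)) * gam.
apply: (is_lim_seq_le_le (fun _ => 0) _ (fun n =>
  (D' * ce + D) * norm h * (1 - radius n) + Cmod (Cinv v0) * 2 ^ k * norm (F (radius n) h))).
- move=> n; split; first exact: norm_ge_0.
  have Hr := radius_bounds n.
  have [HLk _] := op_bound_iter _ _ k (op_bound_affine (S n) _ (Copp c) (RtoC 1) (HS n)).
  have := Hsmall n; rewrite (linear_minus _ _ _ HLk) -Nat.iter_succ_r norm_minus_sym.
  have := HD (radius n) h Hr; have := HD' (radius n) (E n h) Hr.
  rewrite -/(S n) (norm_minus_sym (Nat.iter k N h)).
  have [_ [_ /(_ h) HEn]] : op_bound (E n) ce by apply: op_bound_scal.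
  move=> A1 A2 A3.
  apply: Rle_trans (norm_dist_triangle _ (Nat.iter (Datatypes.S k) (affine (Copp c) (RtoC 1) (S n)) (E n h)) _) _.
  have := norm_dist_triangle (Nat.iter (Datatypes.S k) (affine (Copp c) (RtoC 1) (S n)) (E n h))
    (Nat.iter k (affine (Copp c) (RtoC 1) (S n)) h) (Nat.iter k N h).
  have D'r : 0 <= D' * (1 - radius n) by apply: Rmult_le_pos; lra.
  have := Rmult_le_compat_l _ _ _ D'r HEn.
  lra.
- exact: is_lim_seq_const.
have L1 : is_lim_seq (fun n => 1 - radius n) 0.
  rewrite (_ : Finite 0 = Finite (1 - 1)); last by congr Finite; ring.
  exact: is_lim_seq_minus' (is_lim_seq_const 1) radius_lim.
have L2 : is_lim_seq (fun n => norm (F (radius n) h)) 0.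
  rewrite -(norm_zero (V := H)); apply: limit_norm.
  exact: (filterlim_comp _ _ _ _ _ _ _ _ radius_at_left (Hlim h)).
rewrite (_ : Finite 0 = Finite ((D' * ce + D) * norm h * 0 + Cmod (Cinv v0) * 2 ^ k * 0)); last by congr Finite; ring.
apply: is_lim_seq_plus'.
  exact: (is_lim_seq_mult' _ _ _ _ (is_lim_seq_const _) L1).
exact: (is_lim_seq_mult' _ _ _ _ (is_lim_seq_const _) L2).
Qed.
End ClassC0.

(** The resolvent is the Neumann series [- c^-1 sum (T / c)^n]. *)
Lemma resolvent_outside_disc {H : HilbertSpace} (T : H -> H) c :
  op_bound T 1 -> 1 < Cmod c -> ~ spectrum T c.
Proof.
move=> HT Hc; apply.
have c0 : c <> RtoC 0 by move=> E; move: Hc; rewrite E Cmod_0; lra.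
pose S x := scal (Cinv c) (T x).
have HS : op_bound S (Cmod (Cinv c) * 1) by apply: op_bound_scal.
have Ht : Cmod (Cinv c) * 1 < 1.
  by rewrite Cmod_inv // Rmult_1_r -Rinv_1; apply: Rinv_lt_contravar; lra.
pose a (n : nat) := RtoC 1.
have Ha : disc_series a.
  move=> R HR; exists 1 => n; rewrite /a Cmod_1 Rmult_1_l -(pow1 n).
  by apply: pow_incr; lra.
pose W h := scal (Copp (Cinv c)) (opseries a S h).
have [HL _] := HT.
have HW : is_linear W.
  have HO : op_bound (opseries a S) (1 / (1 - Cmod (Cinv c) * 1)).
    apply: op_bound_intro => [x y|w x||x].
    - exact: (opseries_plus _ _ HS Ht).
    - exact: (opseries_scal _ _ HS Ht).
    - by apply/Rlt_le/Rdiv_lt_0_compat; lra.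
    - have Hq : 0 <= Cmod (Cinv c) * 1 < 1 by have := Cmod_ge_0 (Cinv c); lra.
      rewrite (_ : 1 / _ * norm x = norm x * / (1 - Cmod (Cinv c) * 1)); last by field; lra.
      apply: series_norm_le (opseries_correct _ _ HS Ht a x Ha) (geom_series _ _ Hq) _ => n.
      rewrite norm_scal_C Cmod_1 Rmult_1_l Rmult_comm.
      by case: (op_bound_iter _ _ n HS) => _ [_]; apply.
  by case: (op_bound_scal _ _ (Copp (Cinv c)) HO).
have Hr h : minus (T (W h)) (scal c (W h)) = h.
  have : affine (RtoC 1) (Copp (RtoC 1)) S (opseries a S h) = h.
    rewrite -(opseries_affine _ _ _ _ _ _ HS Ht Ha); apply: opseries_unique.
    apply: (filterlim_ext (fun _ => h)); last exact: filterlim_const.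
    elim=> [|n IH]; first by rewrite sum_O /= /a; module_eq.
    by rewrite sum_Sn -IH /= /a; module_eq.
  move=> E; rewrite -[RHS]E /W (linear_scal T HL) /affine /S.
  by module_eq_with ltac:(field; exact c0).
exists W; split=> //; split=> // h.
have HWT : commutes W T.
  move=> x; rewrite /W (linear_scal T HL); congr (scal _ _).
  have HTS : commutes T S by move=> y; rewrite /S (linear_scal T HL).
  by rewrite (opseries_commutes _ _ HS Ht a T Ha HL HTS).
by rewrite (linear_minus _ _ _ HW) (linear_scal W HW) HWT Hr.
Qed.

Theorem theorem4p6 (H : HilbertSpace) (T : H -> H) :
  is_linear T ->
  class_C0 T ->
  Ext1_eq_0 T T ->
  forall lambda : C, spectrum T lambda -> Cmod lambda = 1%R.
Proof.
move=> HL [[_ Hcontr] [_ [u [[_ [B HB]] [[z0 [Hz0 Hne]] [a [F [Hu [HF Hlim]]]]]]]]] Hext c Hspec.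
have HT : op_bound T 1.
  by split=> //; split=> [|x]; [lra|have := Hcontr x; lra].
case: (Rtotal_order (Cmod c) 1) => [Hc|[//|Hc]]; last first.
  by case: (resolvent_outside_disc T c HT Hc).
case: (approximate_inverses T c HT Hc u a F B z0) => // k [e [E [HE [HC HEl]]]].
set N := affine (Copp c) (RtoC 1) T in HEl.
have HN : is_linear N by case: (op_bound_affine T 1 (Copp c) (RtoC 1) HT).
have HCN n : commutes (E n) N by apply: commutes_affine => //; case: (HE n).
have HPl := kernel_projection_linear N E e k HN HE HCN HEl.
have HPN := kernel_projection_commutes N E e k HN HE HCN HEl.
have HPi := kernel_projection_idem N E e k HN HE HCN HEl.
have HPk := kernel_projection_kernel N E e k HN HE HCN HEl.
set P := kernel_projection N E k in HPl HPN HPi HPk.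
have HTN x : T x = plus (N x) (scal c x) by rewrite /N /affine; module_eq.
have HPT : commutes P T.
  by move=> x; rewrite !HTN (linear_plus P HPl) (linear_scal P HPl) HPN.
(* [P] is a cocycle, hence a commutator [T L - L T = N L - L N]. *)
have Hcoc : ext_cocycle T T P.
  split=> //; exact: upper_triangular_polynomially_bounded Hc HT HPl HPT HPk.
case: (Hext P Hcoc) => L [HLl HLc].
have HP0 : forall h, P h = zero.
  apply: (commutator_with_nilpotent N P L k) => // h.
  have := HLc h; rewrite (_ : minus (P h) zero = P h); last by module_eq.
  move=> ->; rewrite !HTN (linear_plus L HLl) (linear_scal L HLl); module_eq.
case: (invertible_of_trivial_kernel N E e k HN HE HCN HEl HP0) => S [HS [HNS HSN]].
have HNE x : N x = minus (T x) (scal c x) by rewrite /N /affine; module_eq.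
case: Hspec; exists S; split=> //; split=> h.
- by rewrite -HNE.
- by rewrite -HNE.
Qed.
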